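(* Let $k$ be an algebraically closed field of characteristic $p>0$, let $(\mathfrak{g},[p])$ be a finite-dimensional restricted Lie algebra over $k$ such that $V(\mathfrak{g})=\{x\in\mathfrak{g} : x^{[p]}=0\}$ is a subspace of $\mathfrak{g}$, and let $\mathfrak{h}\subseteq\mathfrak{g}$ be a $p$-subalgebra such that $\dim V(\mathfrak{h})\ge 2$. Let $j\in\{1,\ldots,p-1\}$. If $M$ is a finite-dimensional $U_0(\mathfrak{g})$-module of constant $j$-rank, then \[ \deg^j(M)=\deg^j(M|_{\mathfrak{h}}).\]
   Context: $U_0(\mathfrak{g})=U(\mathfrak{g})/(\{x^p-x^{[p]} : x\in\mathfrak{g}\})$ is the restricted enveloping algebra; a $p$-subalgebra is a subalgebra closed under the $p$-map; $M|_{\mathfrak{h}}$ is the restriction of $M$ to $U_0(\mathfrak{h})$, and $V(\mathfrak{h})=V(\mathfrak{g})\cap\mathfrak{h}$. For $x\in\mathfrak{g}$, $x_M:M\to M$ is the operator $m\mapsto x.m$. The generic $j$-rank is $\mathrm{rk}^j(M)=\max\{\mathrm{rk}(x_M^j) : x\in V(\mathfrak{g})\}$, and $M$ has constant $j$-rank if $\mathrm{rk}(x_M^j)=\mathrm{rk}(y_M^j)$ for all $x,y\in V(\mathfrak{g})\setminus\{0\}$. Degree of a morphism: if $U\subseteq\mathbb{P}^n$ is non-empty open and $\varphi:U\to\mathbb{P}^m$ is a morphism, there are homogeneous polynomials $f_0,\ldots,f_m\in k[X_0,\ldots,X_n]$ of the same degree $d$ with $\gcd(f_0,\ldots,f_m)=1$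 and $\varphi(x)=(f_0(x):\cdots:f_m(x))$ for all $x\in U$; they are unique up to a common non-zero scalar, and $\deg(\varphi):=d$. Degree of a module (for a restricted Lie algebra $\mathfrak{g}$ with $V(\mathfrak{g})$ a subspace): let $d_j=\mathrm{rk}^j(M)$. The set $U_{M,j}=\{[x]\in\mathbb{P}(V(\mathfrak{g})) : \mathrm{rk}(x_M^j)=d_j\}$ is open, and $\mathrm{im}^j_M:U_{M,j}\to\mathrm{Gr}_{d_j}(M)$, $[x]\mapsto\mathrm{im}\,x_M^j$, is a morphism to the Grassmannian of $d_j$-dimensional subspaces of $M$. Let $\mathrm{pl}_M:\mathrm{Gr}_{d_j}(M)\to\mathbb{P}(\bigwedge^{d_j}M)$ be the Plücker embedding. The $j$-degree is $\deg^j(M):=\deg(\mathrm{pl}_M\circ\mathrm{im}^j_M)$ if $d_j>0$, and $\deg^j(M):=0$ if $d_j=0$. *)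

(* Defs.v *)
From HB Require Import structures.
From mathcomp Require Import all_boot all_order all_algebra.
From mathcomp Require Import boolp classical_sets.
From mathcomp Require monalg.

Set Implicit Arguments.
Unset Strict Implicit.
Unset Printing Implicit Defensive.

Import GRing.Theory.
Local Open Scope ring_scope.

(* [jacobson_coef br x y n i] is the coefficient of t^i in ad(t x + y)^n (x). *)
Fixpoint jacobson_coef (V : zmodType) (br : V -> V -> V) (x y : V) (n i : nat)
    : V :=
  match n, i with
  | 0, 0 => x
  | 0, _.+1 => 0
  | n'.+1, 0 => br y (jacobson_coef br x y n' 0)
  | n'.+1, i'.+1 =>
      br x (jacobson_coef br x y n' i') + br y (jacobson_coef br x y n' i'.+1)
  end.

(* The summand of index i in [pmapD] is Jacobson's s_i(x, y), where i s_i(x, y) *)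
(* is the coefficient of t^(i-1) in ad(t x + y)^(p-1) (x).  Carriers are        *)
(* finite-dimensional, being [vectType]s.                                       *)
Record restrictedLieAlg (k : fieldType) (p : nat) := RestrictedLieAlg {
  rlie_sort :> vectType k;
  rlie_pchar : p \in [pchar k];
  bracket : rlie_sort -> rlie_sort -> rlie_sort;
  pmap : rlie_sort -> rlie_sort;
  bracket_linearl : forall y, linear (bracket^~ y);
  bracket_linearr : forall x, linear (bracket x);
  bracket_alt : forall x, bracket x x = 0;
  bracket_jacobi : forall x y z,
    bracket x (bracket y z) + bracket y (bracket z x)
      + bracket z (bracket x y) = 0;
  pmap_ad : forall x y, bracket (pmap x) y = iter p (bracket x) y;
  pmapZ : forall a x, pmap (a *: x) = a ^+ p *: pmap x;
  pmapD : forall x y, pmap (x + y) = pmap x + pmap y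
    + \sum_(1 <= i < p) i%:R^-1 *: jacobson_coef bracket x y p.-1 i.-1
}.

Section AlgebraQuotient.
Variables (k : fieldType) (A : algType k) (X : set A).

Inductive gen_ideal : A -> Prop :=
| gen_ideal_in x : X x -> gen_ideal x
| gen_ideal0 : gen_ideal 0
| gen_idealD x y : gen_ideal x -> gen_ideal y -> gen_ideal (x + y)
| gen_idealMl a x : gen_ideal x -> gen_ideal (a * x)
| gen_idealMr a x : gen_ideal x -> gen_ideal (x * a).

Lemma gen_idealN x : gen_ideal x -> gen_ideal (- x).
Proof. by rewrite -mulN1r; exact: gen_idealMl. Qed.

Lemma gen_idealB x y : gen_ideal x -> gen_ideal y -> gen_ideal (x - y).
Proof. by move=> Ix Iy; apply: gen_idealD => //; exact: gen_idealN. Qed.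

Definition ideal_eqv (x y : A) : bool := `[< gen_ideal (x - y) >].

Lemma ideal_eqv_refl : reflexive ideal_eqv.
Proof. by move=> x; apply/asboolP; rewrite subrr; exact: gen_ideal0. Qed.

Lemma ideal_eqv_sym : symmetric ideal_eqv.
Proof.
by move=> x y; apply/asboolP/asboolP => /gen_idealN; rewrite opprB.
Qed.

Lemma ideal_eqv_trans : transitive ideal_eqv.
Proof.
move=> y x z /asboolP Ixy /asboolP Iyz; apply/asboolP.
by have := gen_idealD Ixy Iyz; rewrite addrA subrK.
Qed.

Canonical ideal_equiv_rel :=
  EquivRel ideal_eqv ideal_eqv_refl ideal_eqv_sym ideal_eqv_trans.

(* The augmentation [aug] killing [X] serves only to make the quotient a        *)
(* nontrivial ring, as the [algType] structure demands.                         *)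
Variables (aug : {lrmorphism A -> k | *%R}).

Definition alg_quot (augX : forall x, X x -> aug x = 0) : Type :=
  {eq_quot ideal_equiv_rel}%qT.

Hypothesis augX : forall x, X x -> aug x = 0.
Local Notation Q := (alg_quot augX).

HB.instance Definition _ := Choice.on Q.
HB.instance Definition _ := EqQuotient.on Q.

Definition quot_pi (x : A) : Q := \pi_Q%qT x.

Lemma quot_piP x y : quot_pi x = quot_pi y <-> gen_ideal (x - y).
Proof.
split=> [/eqmodP/= /asboolP //|Ixy].
by apply/eqmodP; apply/asboolP.
Qed.

Lemma quot_reprK (u : Q) : quot_pi (repr u) = u.
Proof. exact: reprK. Qed.

Lemma quot_piW (P : Q -> Prop) : (forall x, P (quot_pi x)) -> forall u, P u.
Proof. by move=> PP u; rewrite -[u]quot_reprK. Qed.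

Lemma gen_ideal_repr x : gen_ideal (repr (quot_pi x) - x).
Proof. by apply/quot_piP; rewrite quot_reprK. Qed.

Definition quot_add (u v : Q) : Q := quot_pi (repr u + repr v).
Definition quot_opp (u : Q) : Q := quot_pi (- repr u).
Definition quot_mul (u v : Q) : Q := quot_pi (repr u * repr v).
Definition quot_scale (a : k) (u : Q) : Q := quot_pi (a *: repr u).

Lemma quot_addE x y : quot_add (quot_pi x) (quot_pi y) = quot_pi (x + y).
Proof.
apply/quot_piP; rewrite opprD addrACA.
by apply: gen_idealD; exact: gen_ideal_repr.
Qed.

Lemma quot_oppE x : quot_opp (quot_pi x) = quot_pi (- x).
Proof.
by apply/quot_piP; rewrite -opprD; apply: gen_idealN; exact: gen_ideal_repr.
Qed.

Lemma quot_mulE x y : quot_mul (quot_pi x) (quot_pi y) = quot_pi (x * y).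
Proof.
apply/quot_piP; set x' := repr _; set y' := repr _.
have -> : x' * y' - x * y = (x' - x) * y' + x * (y' - y).
  by rewrite mulrBl mulrBr addrA subrK.
by apply: gen_idealD; [apply: gen_idealMr|apply: gen_idealMl];
  exact: gen_ideal_repr.
Qed.

Lemma quot_scaleE a x : quot_scale a (quot_pi x) = quot_pi (a *: x).
Proof.
apply/quot_piP; rewrite -scalerBr -mulr_algl.
by apply: gen_idealMl; exact: gen_ideal_repr.
Qed.

Let quotE := (quot_addE, quot_oppE, quot_mulE, quot_scaleE).

Fact quot_addA : associative quot_add.
Proof. by do 3!elim/quot_piW=> ?; rewrite !quotE addrA. Qed.
Fact quot_addC : commutative quot_add.
Proof. by do 2!elim/quot_piW=> ?; rewrite !quotE addrC. Qed.
Fact quot_add0 : left_id (quot_pi 0) quot_add.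
Proof. by elim/quot_piW=> ?; rewrite !quotE add0r. Qed.
Fact quot_addN : left_inverse (quot_pi 0) quot_opp quot_add.
Proof. by elim/quot_piW=> ?; rewrite !quotE addNr. Qed.

HB.instance Definition _ :=
  GRing.isZmodule.Build Q quot_addA quot_addC quot_add0 quot_addN.

Fact quot_mulA : associative quot_mul.
Proof. by do 3!elim/quot_piW=> ?; rewrite !quotE mulrA. Qed.
Fact quot_mul1 : left_id (quot_pi 1) quot_mul.
Proof. by elim/quot_piW=> ?; rewrite !quotE mul1r. Qed.
Fact quot_mulr1 : right_id (quot_pi 1) quot_mul.
Proof. by elim/quot_piW=> ?; rewrite !quotE mulr1. Qed.
Fact quot_mulDl : left_distributive quot_mul quot_add.
Proof. by do 3!elim/quot_piW=> ?; rewrite !quotE mulrDl. Qed.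
Fact quot_mulDr : right_distributive quot_mul quot_add.
Proof. by do 3!elim/quot_piW=> ?; rewrite !quotE mulrDr. Qed.

Lemma aug_gen_ideal x : gen_ideal x -> aug x = 0.
Proof.
elim=> {x} [x /augX //||x y _ xE _ yE|a x _ xE|a x _ xE].
- exact: raddf0.
- by rewrite raddfD /= xE yE addr0.
- by rewrite rmorphM /= xE mulr0.
- by rewrite rmorphM /= xE mul0r.
Qed.

Fact quot_one_neq0 : quot_pi 1 != quot_pi 0.
Proof.
apply/eqP => /quot_piP /aug_gen_ideal; rewrite subr0 rmorph1.
by apply/eqP; exact: oner_neq0.
Qed.

HB.instance Definition _ := GRing.Zmodule_isNzRing.Build Q
  quot_mulA quot_mul1 quot_mulr1 quot_mulDl quot_mulDr quot_one_neq0.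

Fact quot_scaleA a b u : quot_scale a (quot_scale b u) = quot_scale (a * b) u.
Proof. by elim/quot_piW: u => ?; rewrite !quotE scalerA. Qed.
Fact quot_scale1 : left_id 1 quot_scale.
Proof. by elim/quot_piW=> ?; rewrite !quotE scale1r. Qed.
Fact quot_scaleDr : right_distributive quot_scale +%R.
Proof.
by move=> a; do 2!elim/quot_piW=> ?; rewrite /+%R /= !quotE scalerDr.
Qed.
Fact quot_scaleDl u : {morph quot_scale^~ u : a b / a + b}.
Proof.
by elim/quot_piW: u => ? ? ?; rewrite [in RHS]/+%R /= !quotE scalerDl.
Qed.

HB.instance Definition _ := GRing.Zmodule_isLmodule.Build k Q
  quot_scaleA quot_scale1 quot_scaleDr quot_scaleDl.

Fact quot_scaleAl a (u v : Q) : a *: (u * v) = (a *: u) * v.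
Proof.
elim/quot_piW: u => x; elim/quot_piW: v => y.
by rewrite /*:%R /*%R /= !quotE scalerAl.
Qed.
HB.instance Definition _ := GRing.Lmodule_isLalgebra.Build k Q quot_scaleAl.

Fact quot_scaleAr a (u v : Q) : a *: (u * v) = u * (a *: v).
Proof.
elim/quot_piW: u => x; elim/quot_piW: v => y.
by rewrite /*:%R /*%R /= !quotE scalerAr.
Qed.
HB.instance Definition _ := GRing.Lalgebra_isAlgebra.Build k Q quot_scaleAr.

Fact quot_pi_zmod : zmod_morphism quot_pi.
Proof.
by move=> x y; rewrite /GRing.opp /GRing.add /= !quotE.
Qed.
HB.instance Definition _ := GRing.isZmodMorphism.Build A Q quot_pi quot_pi_zmod.

Fact quot_pi_monoid : monoid_morphism quot_pi.
Proof. by split=> // x y; rewrite [in RHS]/*%R /= !quotE. Qed.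
HB.instance Definition _ :=
  GRing.isMonoidMorphism.Build A Q quot_pi quot_pi_monoid.

Fact quot_pi_scalable : scalable quot_pi.
Proof. by move=> a x; rewrite [in RHS]/*:%R /= !quotE. Qed.
HB.instance Definition _ :=
  GRing.isScalable.Build k A Q *:%R quot_pi quot_pi_scalable.

Section Lift.
Variables (B : pzRingType) (s : k -> B -> B) (f : {lrmorphism A -> B | s}).

Definition quot_lift (fX : forall x, X x -> f x = 0) (u : Q) : B := f (repr u).

Hypothesis fX : forall x, X x -> f x = 0.
Local Notation qlift := (quot_lift fX).

Lemma gen_ideal_lift x : gen_ideal x -> f x = 0.
Proof.
elim=> {x} [x /fX //||x y _ xE _ yE|a x _ xE|a x _ xE].
- exact: raddf0.
- by rewrite raddfD /= xE yE addr0.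
- by rewrite rmorphM /= xE mulr0.
- by rewrite rmorphM /= xE mul0r.
Qed.

Lemma quot_liftE x : qlift (quot_pi x) = f x.
Proof.
apply/eqP; rewrite -subr_eq0 -raddfB /=.
by apply/eqP/gen_ideal_lift; exact: gen_ideal_repr.
Qed.

Fact quot_lift_zmod : zmod_morphism qlift.
Proof.
by do 2!elim/quot_piW=> ?; rewrite -raddfB !quot_liftE raddfB.
Qed.
HB.instance Definition _ := GRing.isZmodMorphism.Build Q B qlift quot_lift_zmod.

Fact quot_lift_monoid : monoid_morphism qlift.
Proof.
split; first by rewrite quot_liftE rmorph1.
by do 2!elim/quot_piW=> ?; rewrite -rmorphM !quot_liftE rmorphM.
Qed.
HB.instance Definition _ :=
  GRing.isMonoidMorphism.Build Q B qlift quot_lift_monoid.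

Fact quot_lift_scalable : scalable_for s qlift.
Proof.
by move=> a; elim/quot_piW=> ?; rewrite -linearZ /= !quot_liftE linearZ_LR.
Qed.
HB.instance Definition _ := GRing.isScalable.Build k Q B s qlift
  quot_lift_scalable.

End Lift.

End AlgebraQuotient.

Arguments quot_lift {k A X aug} augX {B s f} fX u : simpl never.

(* [monalg] is imported only here: its notations clash with those of [mpoly]. *)
Module Import FreeAlg.
Import monalg.

Section FreeAlgebra.
Variables (k : fieldType) (S : choiceType).

Definition free_alg : Type := {malg k[{fmonom S}]}.
HB.instance Definition _ := GRing.Lalgebra.on free_alg.

Fact free_alg_scaleAr (a : k) (u v : free_alg) : a *: (u * v) = u * (a *: v).
Proof.
have malgCr (c : k) (w : {malg k[{fmonom S}]}) : w * c%:MP = c *: w.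
  rewrite malgM_def malgZ_def /fgscale fgmulgU.
  by apply: eq_bigr => m _; rewrite mulm1 mulrC.
transitivity ((u : {malg k[{fmonom S}]}) * (a *: (v : {malg k[{fmonom S}]}))).
  rewrite -[in RHS]mul_malgC mulrA malgCr -scalerAl //.
by [].
Qed.
HB.instance Definition _ := GRing.Lalgebra_isAlgebra.Build k free_alg
  free_alg_scaleAr.

Definition free_gen (x : S) : free_alg := << fmu x >>.

(* The constant term. *)
Definition free_aug : free_alg -> k := @mcoeff {fmonom S} k mone.
HB.instance Definition _ := GRing.isZmodMorphism.Build free_alg k free_aug
  (raddfB (@mcoeff {fmonom S} k mone)).
HB.instance Definition _ := GRing.isMonoidMorphism.Build free_alg k free_aug
  (rmorph1 (@mcoeff {fmonom S} k mone), rmorphM (@mcoeff {fmonom S} k mone)).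
HB.instance Definition _ := GRing.isScalable.Build k free_alg k *%R free_aug
  (fun a u => mcoeffZ a u mone).

Lemma free_aug_gen x : free_aug (free_gen x) = 0.
Proof.
rewrite /free_aug /free_gen mcoeffU1; case: eqP => // /(congr1 (@fmonom_val S)).
by rewrite fm1 fmuE.
Qed.

Section Eval.
Variables (B : algType k) (f : S -> B).

Definition fmonom_eval (m : {fmonom S}) : B := \prod_(x <- m) f x.

Fact fmonom_eval_mmorphism : mmorphism fmonom_eval.
Proof.
split=> [m n|]; rewrite /fmonom_eval; last by rewrite fm1 big_nil.
by rewrite /mmul /= fmmulE big_cat.
Qed.
HB.instance Definition _ :=
  isMultiplicative.Build {fmonom S} B fmonom_eval fmonom_eval_mmorphism.

Definition free_eval : free_alg -> B := mmap (in_alg B) fmonom_eval.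

Fact free_eval_zmod : zmod_morphism free_eval.
Proof. exact: raddfB. Qed.
HB.instance Definition _ :=
  GRing.isZmodMorphism.Build free_alg B free_eval free_eval_zmod.

Fact free_eval_monoid : monoid_morphism free_eval.
Proof.
have comm (g : {malg k[{fmonom S}]}) m m' :
    GRing.comm (in_alg B (mcoeff m g)) (fmonom_eval m').
  by rewrite /GRing.comm -scalerAl -scalerAr mul1r mulr1.
have [M1 M2] := commr_mmap_is_multiplicative comm.
by split.
Qed.
HB.instance Definition _ :=
  GRing.isMonoidMorphism.Build free_alg B free_eval free_eval_monoid.

Fact free_eval_scalable : scalable free_eval.
Proof. by move=> a u; rewrite /free_eval mmapZ mulr_algl. Qed.
HB.instance Definition _ :=
  GRing.isScalable.Build k free_alg B *:%R free_eval free_eval_scalable.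

Lemma free_eval_gen x : free_eval (free_gen x) = f x.
Proof.
by rewrite /free_eval mmapU /= scale1r mul1r /fmonom_eval fmuE big_seq1.
Qed.

End Eval.

End FreeAlgebra.

End FreeAlg.

Section RestrictedEnveloping.
Variables (k : fieldType) (p : nat) (L : restrictedLieAlg k p).

(* Linearity of L -> U(L), and xy - yx = [x, y]: these present U(L) as a        *)
(* quotient of the free algebra on the set L.                                   *)
Definition env_rels : set (free_alg k L) := [set u |
  (exists a x y,
    u = free_gen k (a *: x + y) - (a *: free_gen k x + free_gen k y)) \/
  (exists x y,
    u = free_gen k x * free_gen k y - free_gen k y * free_gen k x
        - free_gen k (bracket x y))].

Lemma env_rels_aug u : env_rels u -> free_aug u = 0.
Proof.
case=> [[a [x [y ->]]]|[x [y ->]]].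
- by rewrite !raddfB raddfD /= linearZ /= !free_aug_gen mulr0 addr0 subrr.
- by rewrite !raddfB /= !rmorphM /= !free_aug_gen mulr0 !subrr.
Qed.

Definition env_alg : Type := alg_quot env_rels_aug.
HB.instance Definition _ := GRing.Algebra.on env_alg.

Definition env_in (x : L) : env_alg := quot_pi env_rels_aug (free_gen k x).
Definition env_aug : env_alg -> k := quot_lift env_rels_aug env_rels_aug.
HB.instance Definition _ := GRing.LRMorphism.copy env_aug
  (quot_lift env_rels_aug env_rels_aug).

Definition restr_rels : set env_alg :=
  [set u | exists x : L, u = env_in x ^+ p - env_in (pmap x)].

Lemma env_aug_in x : env_aug (env_in x) = 0.
Proof. by rewrite [LHS]quot_liftE [LHS]free_aug_gen. Qed.

Lemma restr_rels_aug u : restr_rels u -> env_aug u = 0.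
Proof.
case=> x ->; rewrite rmorphB rmorphXn /= !env_aug_in subr0 expr0n.
by have /andP[/prime_gt0 + _] := rlie_pchar L; case: (p).
Qed.

Definition restr_env : Type := alg_quot restr_rels_aug.
HB.instance Definition _ := GRing.Algebra.on restr_env.

Definition restr_env_in (x : L) : restr_env :=
  quot_pi restr_rels_aug (env_in x).

Section Universal.
Variables (B : algType k) (f : L -> B).
Hypotheses (f_linear : linear f)
  (f_bracket : forall x y, f (bracket x y) = f x * f y - f y * f x)
  (f_pmap : forall x, f (pmap x) = f x ^+ p).

Lemma env_rels_eval u : env_rels u -> free_eval f u = 0.
Proof.
case=> [[a [x [y ->]]]|[x [y ->]]].
- by rewrite !raddfB raddfD /= linearZ /= !free_eval_gen f_linear subrr.
- by rewrite !raddfB /= !rmorphM /= !free_eval_gen f_bracket subrr.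
Qed.

Definition env_lift : env_alg -> B := quot_lift env_rels_aug env_rels_eval.
HB.instance Definition _ := GRing.LRMorphism.copy env_lift
  (quot_lift env_rels_aug env_rels_eval).

Lemma env_lift_in x : env_lift (env_in x) = f x.
Proof. by rewrite [LHS]quot_liftE [LHS]free_eval_gen. Qed.

Lemma restr_rels_lift u : restr_rels u -> env_lift u = 0.
Proof.
by case=> x ->; rewrite rmorphB rmorphXn /= !env_lift_in f_pmap subrr.
Qed.

Definition restr_env_lift : restr_env -> B :=
  quot_lift restr_rels_aug restr_rels_lift.
HB.instance Definition _ := GRing.LRMorphism.copy restr_env_lift
  (quot_lift restr_rels_aug restr_rels_lift).

Lemma restr_env_lift_in x : restr_env_lift (restr_env_in x) = f x.
Proof. by rewrite [LHS]quot_liftE [LHS]env_lift_in. Qed.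

End Universal.

Lemma env_in_linear : linear env_in.
Proof.
move=> a x y; rewrite /env_in -linearZ -raddfD; apply/quot_piP.
by apply: gen_ideal_in; left; exists a, x, y.
Qed.

Lemma env_in_bracket x y :
  env_in (bracket x y) = env_in x * env_in y - env_in y * env_in x.
Proof.
rewrite /env_in -!rmorphM -raddfB; apply/esym/quot_piP.
by apply: gen_ideal_in; right; exists x, y.
Qed.

Lemma restr_env_in_linear : linear restr_env_in.
Proof. by move=> a x y; rewrite /restr_env_in env_in_linear linearP. Qed.

Lemma restr_env_in_bracket x y : restr_env_in (bracket x y) =
  restr_env_in x * restr_env_in y - restr_env_in y * restr_env_in x.
Proof. by rewrite /restr_env_in env_in_bracket raddfB /= !rmorphM. Qed.

Lemma restr_env_in_pmap x : restr_env_in (pmap x) = restr_env_in x ^+ p.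
Proof.
rewrite /restr_env_in -rmorphXn; apply/esym/quot_piP.
by apply: gen_ideal_in; exists x.
Qed.

End RestrictedEnveloping.

Section PSubalgebra.
Variables (k : fieldType) (p : nat) (L : restrictedLieAlg k p).

Definition p_subalgebra (h : {vspace L}) : Prop :=
  (forall x y, x \in h -> y \in h -> bracket x y \in h) /\
  (forall x, x \in h -> pmap x \in h).

Variables (h : {vspace L}) (hh : p_subalgebra h).
Local Notation S := (subvs_of h).

Definition sub_bracket (x y : S) : S := vsproj h (bracket (vsval x) (vsval y)).
Definition sub_pmap (x : S) : S := vsproj h (pmap (vsval x)).

Lemma val_sub_bracket x y :
  vsval (sub_bracket x y) = bracket (vsval x) (vsval y).
Proof. by rewrite vsprojK //; apply: hh.1; exact: subvsP. Qed.

Lemma val_sub_pmap x : vsval (sub_pmap x) = pmap (vsval x).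
Proof. by rewrite vsprojK //; apply: hh.2; exact: subvsP. Qed.

Fact sub_bracket_linearl y : linear (sub_bracket^~ y).
Proof.
move=> a x z; apply: subvs_inj; rewrite linearP /= !val_sub_bracket linearP.
exact: bracket_linearl.
Qed.

Fact sub_bracket_linearr x : linear (sub_bracket x).
Proof.
move=> a y z; apply: subvs_inj; rewrite linearP /= !val_sub_bracket linearP.
exact: bracket_linearr.
Qed.

Fact sub_bracket_alt x : sub_bracket x x = 0.
Proof. by apply: subvs_inj; rewrite val_sub_bracket bracket_alt linear0. Qed.

Fact sub_bracket_jacobi x y z :
  sub_bracket x (sub_bracket y z) + sub_bracket y (sub_bracket z x)
    + sub_bracket z (sub_bracket x y) = 0.
Proof.
apply: subvs_inj; rewrite !raddfD /= !val_sub_bracket bracket_jacobi.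
by [].
Qed.

Fact sub_pmap_ad x y : sub_bracket (sub_pmap x) y = iter p (sub_bracket x) y.
Proof.
apply: subvs_inj; rewrite val_sub_bracket val_sub_pmap pmap_ad.
have val_iter n : vsval (iter n (sub_bracket x) y)
    = iter n (bracket (vsval x)) (vsval y).
  by elim: n => //= n <-; rewrite val_sub_bracket.
exact/esym/val_iter.
Qed.

Fact sub_pmapZ a x : sub_pmap (a *: x) = a ^+ p *: sub_pmap x.
Proof.
by apply: subvs_inj; rewrite linearZ /= !val_sub_pmap linearZ pmapZ.
Qed.

Lemma val_sub_jacobson x y n i :
  vsval (jacobson_coef sub_bracket x y n i)
    = jacobson_coef (@bracket k p L) (vsval x) (vsval y) n i.
Proof.
elim: n i => [[|i]|n IH [|i]] //=.
  by rewrite val_sub_bracket IH.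
by rewrite !val_sub_bracket !IH.
Qed.

Fact sub_pmapD x y : sub_pmap (x + y) = sub_pmap x + sub_pmap y
  + \sum_(1 <= i < p) i%:R^-1 *: jacobson_coef sub_bracket x y p.-1 i.-1.
Proof.
apply: subvs_inj; rewrite !raddfD /= !val_sub_pmap raddfD /= pmapD.
rewrite linear_sum /=; congr (_ + _); apply: eq_bigr => i _.
by rewrite /= val_sub_jacobson.
Qed.

Definition sub_rlie : restrictedLieAlg k p :=
  RestrictedLieAlg (rlie_pchar L) sub_bracket_linearl sub_bracket_linearr
    sub_bracket_alt sub_bracket_jacobi sub_pmap_ad sub_pmapZ sub_pmapD.

Definition sub_env_gen (x : sub_rlie) : restr_env L := restr_env_in (vsval x).

Fact sub_env_gen_linear : linear sub_env_gen.
Proof.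
by move=> a x y; rewrite /sub_env_gen linearP restr_env_in_linear.
Qed.

Fact sub_env_gen_bracket x y : sub_env_gen (bracket x y) =
  sub_env_gen x * sub_env_gen y - sub_env_gen y * sub_env_gen x.
Proof. by rewrite /sub_env_gen val_sub_bracket restr_env_in_bracket. Qed.

Fact sub_env_gen_pmap x : sub_env_gen (pmap x) = sub_env_gen x ^+ p.
Proof. by rewrite /sub_env_gen val_sub_pmap restr_env_in_pmap. Qed.

Definition sub_env : restr_env sub_rlie -> restr_env L :=
  restr_env_lift sub_env_gen_linear sub_env_gen_bracket sub_env_gen_pmap.
HB.instance Definition _ := GRing.LRMorphism.copy sub_env
  (restr_env_lift sub_env_gen_linear sub_env_gen_bracket sub_env_gen_pmap).

End PSubalgebra.

Arguments sub_env {k p L h} hh u.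

Record fdModule (k : fieldType) (A : algType k) := FdModule {
  fdmod_sort :> vectType k;
  fdact : A -> 'End(fdmod_sort);
  fdact_linear : linear fdact;
  fdact1 : fdact 1 = \1%VF;
  fdactM : forall a b, fdact (a * b) = (fdact a \o fdact b)%VF
}.

Section Pullback.
Variables (k : fieldType) (A B : algType k) (f : {lrmorphism A -> B}).
Variable M : fdModule B.

Definition pullback_act (a : A) : 'End(M) := fdact M (f a).

Fact pullback_act_linear : linear pullback_act.
Proof. by move=> a x y; rewrite /pullback_act linearP fdact_linear. Qed.
Fact pullback_act1 : pullback_act 1 = \1%VF.
Proof. by rewrite /pullback_act rmorph1 fdact1. Qed.
Fact pullback_actM a b :
  pullback_act (a * b) = (pullback_act a \o pullback_act b)%VF.
Proof. by rewrite /pullback_act rmorphM fdactM. Qed.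

Definition pullback : fdModule A :=
  FdModule pullback_act_linear pullback_act1 pullback_actM.
End Pullback.

Definition restrict_mod (k : fieldType) (p : nat) (L : restrictedLieAlg k p)
    (h : {vspace L}) (hh : p_subalgebra h) (M : fdModule (restr_env L)) :
    fdModule (restr_env (sub_rlie hh)) :=
  pullback (sub_env hh) M.

(* Not earlier: [mpoly] shadows [symmetric]. *)
From mathcomp Require Import mpoly.

Section MorphismDegree.
Variables (k : fieldType) (W E : vectType k).

Definition coprime_family (n : nat) (I : Type) (f : I -> {mpoly k[n]}) : Prop :=
  forall q : {mpoly k[n]},
    (forall i, exists r : {mpoly k[n]}, f i = r * q) -> q \is a GRing.unit.

(* A point of P(W) is given by a nonzero vector of W, and a point of P(E) is    *)
(* the line it stands for, as a subspace of E; [X_l] is the l-th coordinate on  *)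
(* W, and [f_i] the i-th coordinate on E, with respect to the chosen bases.     *)
Definition represents_morphism (U : set W) (phi : W -> {vspace E}) (d : nat)
    (f : 'I_(\dim {:E}) -> {mpoly k[\dim {:W}]}) : Prop :=
  [/\ forall i, f i \is d.-homog,
      coprime_family f
    & forall x, x != 0 -> U x ->
        let y := \sum_i (f i).@[fun l => coord (vbasis {:W}) l x]
                   *: (vbasis {:E})`_i in
        y != 0 /\ phi x = <[y]>%VS].

Definition morphism_degree (U : set W) (phi : W -> {vspace E}) : nat :=
  xget 0%N [set d | exists f, represents_morphism U phi d f].

End MorphismDegree.

Section Plucker.
Variables (k : fieldType) (M : vectType k) (d : nat).

Definition increasing_map : Type :=
  {s : {ffun 'I_d -> 'I_(\dim {:M})} |
    [forall i : 'I_d, forall j : 'I_d, (i < j)%N ==> (s i < s j)%N]}.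
HB.instance Definition _ := Finite.on increasing_map.

(* The d-th exterior power of M, on its basis e_s = e_(s 1) /\ ... /\ e_(s d),  *)
(* for e the chosen basis of M and s increasing.                                *)
Definition exterior_power : vectType k := {ffun increasing_map -> k^o}.

(* The coefficient of v_1 /\ ... /\ v_d on e_s is the minor with columns s of   *)
(* the matrix of coordinates of the v_i.                                        *)
Definition wedge (v : 'I_d -> M) : exterior_power :=
  [ffun s : increasing_map =>
     \det (\matrix_(i < d, l < d) coord (vbasis {:M}) (val s l) (v i))].

(* Meaningful for \dim N = d, that is for N in Gr_d(M). *)
Definition plucker (N : {vspace M}) : {vspace exterior_power} :=
  <[wedge (fun i => (vbasis N)`_i)]>%VS.

End Plucker.

Section JDegree.
Variables (k : fieldType) (p : nat) (L : restrictedLieAlg k p).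

Definition nullcone : set L := [set x | pmap x = 0].

Definition is_nullspace (V : {vspace L}) : Prop :=
  forall x, x \in V <-> nullcone x.

Definition nullcone_is_subspace : Prop := exists V, is_nullspace V.

(* V(L) as a {vspace L}; junk when V(L) is not a subspace. *)
Definition nullspace : {vspace L} := xget 0%VS [set V | is_nullspace V].

Variable M : fdModule (restr_env L).

Definition operator (x : L) : 'End(M) := fdact M (restr_env_in x).

Definition operator_pow (x : L) (j : nat) : 'End(M) :=
  iter j (comp_lfun (operator x)) \1%VF.

Definition oprank (j : nat) (x : L) : nat := \dim (limg (operator_pow x j)).

(* The ranks occurring are at most dim M, so this is their maximum. *)
Definition generic_rank (j : nat) : nat :=
  \max_(r < (\dim {:M}).+1 | `[< exists2 x, nullcone x & oprank j x = r >]) r.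

Definition constant_rank (j : nat) : Prop :=
  forall x y, nullcone x -> nullcone y -> x != 0 -> y != 0 ->
    oprank j x = oprank j y.

(* As in [represents_morphism], points of P(V(L)) are given by nonzero vectors. *)
Definition degree_locus (j : nat) : set (subvs_of nullspace) :=
  [set x | oprank j (vsval x) = generic_rank j].

Definition image_map (j : nat) (x : subvs_of nullspace) : {vspace M} :=
  limg (operator_pow (vsval x) j).

Definition jdegree (j : nat) : nat :=
  if (0 < generic_rank j)%N then
    morphism_degree (degree_locus j)
      (fun x => plucker (generic_rank j) (image_map j x))
  else 0%N.

End JDegree.

(* Main.v *)
Require Import Defs.
From HB Require Import structures.
From mathcomp Require Import all_boot all_order all_algebra.
From mathcomp Require Import boolp classical_sets.
From mathcomp Require Import mpoly.

Set Implicit Arguments.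
Unset Strict Implicit.
Unset Printing Implicit Defensive.

Import GRing.Theory.
Local Open Scope ring_scope.

(* On V(g) the operators x_M^j have a matrix of polynomial entries, so the      *)
(* families of their d x d minors, d being the constant rank, represent         *)
(* pl_M o im^j_M locally.  As polynomial rings are factorial, dividing one      *)
(* family by its greatest common divisor represents the morphism globally, by   *)
(* coprime forms f_i without common zero on V(g) \ 0.  The restrictions of the  *)
(* f_i to V(h) have the same degree and no common zero on V(h) \ 0; as          *)
(* dim V(h) >= 2 and k is algebraically closed, every nonconstant form on V(h)  *)
(* has a nontrivial zero, so these restrictions are still coprime.  Hence they  *)
(* compute the degree of M|_h.                                                  *)

(** * Factorial rings *)

Section Divisibility.
Variable R : idomainType.
Implicit Types (a b c q : R).

Definition divides a b : Prop := exists r, b = r * a.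

Definition prime_element q : Prop :=
  [/\ q != 0, q \isn't a GRing.unit
    & forall a b, divides q (a * b) -> divides q a \/ divides q b].

Inductive prime_length : nat -> R -> Prop :=
| prime_length0 u : u \is a GRing.unit -> prime_length 0 u
| prime_lengthS n q a :
    prime_element q -> prime_length n a -> prime_length n.+1 (q * a).

Definition factorial_ring : Prop :=
  forall a, a != 0 -> exists n, prime_length n a.

Lemma dividesMl q a b : divides q a -> divides q (b * a).
Proof. by case=> r ->; exists (b * r); rewrite mulrA. Qed.

Lemma dividesMr q a b : divides q a -> divides q (a * b).
Proof. by rewrite mulrC; exact: dividesMl. Qed.

Lemma dividesD q a b : divides q a -> divides q b -> divides q (a + b).
Proof. by move=> [r ->] [s ->]; exists (r + s); rewrite mulrDl. Qed.

Lemma divides_unit q u : u \is a GRing.unit -> divides q u -> q \is a GRing.unit.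
Proof. by move=> Uu [r uE]; move: Uu; rewrite uE unitrM => /andP[]. Qed.

Lemma prime_length0_unit a : prime_length 0 a -> a \is a GRing.unit.
Proof. by move=> afact; inversion afact. Qed.

Lemma prime_length_unit n u a :
  u \is a GRing.unit -> prime_length n a -> prime_length n (u * a).
Proof.
move=> Uu; elim=> {n a} [v Uv|n q a q_pr _ IH].
  by apply: prime_length0; rewrite unitrM Uu.
by rewrite mulrCA; apply: prime_lengthS.
Qed.

Lemma prime_length_cancel n a q b :
  prime_element q -> prime_length n a -> a = q * b ->
  exists2 m, n = m.+1 & prime_length m b.
Proof.
move=> q_pr afact; elim: afact b => {n a} [u Uu|n s a s_pr afact IH] b.
  move=> uE; case: q_pr => _ /negP[]; apply: divides_unit Uu _.
  by exists b; rewrite mulrC.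
move=> saE; have [q_neq0 q_nunit qP] := q_pr; have [s_neq0 s_nunit sP] := s_pr.
have /qP[[v sE]|[a' aE]] : divides q (s * a) by exists b; rewrite saE mulrC.
  have Uv : v \is a GRing.unit.
    have /sP[[w vE]|[w qE]] : divides s (v * q) by exists 1; rewrite mul1r sE.
      case/negP: q_nunit; apply/unitrP; exists w.
      suff wq1 : w * q = 1 by split; rewrite // mulrC.
      apply: (mulfI s_neq0).
      by rewrite mulr1 mulrCA mulrA -vE -sE.
    apply/unitrP; exists w.
    suff wv1 : w * v = 1 by split; rewrite // mulrC.
    by apply: (mulIf q_neq0); rewrite mul1r -mulrA -sE -qE.
  exists n => //; suff -> : b = v * a by apply: prime_length_unit.
  by apply: (mulfI q_neq0); rewrite -saE sE; rewrite mulrCA mulrA.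
have bE : b = s * a'.
  by apply: (mulfI q_neq0); rewrite -saE aE (mulrC a') mulrCA.
have [m nE a'fact] := IH a' (etrans aE (mulrC _ _)).
by exists m.+1; rewrite ?nE // bE; apply: prime_lengthS.
Qed.

Lemma prime_length_neq0 n a : prime_length n a -> a != 0.
Proof.
elim=> {n a} [u Uu|n q a [q_neq0 _ _] _ a_neq0].
  by apply: contraTneq Uu => ->; rewrite unitr0.
by rewrite mulf_neq0.
Qed.

Lemma prime_lengthM m n a b :
  prime_length m a -> prime_length n b -> prime_length (m + n) (a * b).
Proof.
move=> afact bfact; elim: afact => {m a} [u Uu|m q a q_pr _ IH].
  exact: prime_length_unit.
by rewrite -mulrA addSn; apply: prime_lengthS.
Qed.

Lemma prime_divisor n a : prime_length n a -> a \isn't a GRing.unit ->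
  exists2 q, prime_element q & divides q a.
Proof.
case=> {n a} [u -> //|n q a q_pr _ _].
by exists q => //; exists a; rewrite mulrC.
Qed.

Definition coprime_tuple (I : Type) (f : I -> R) : Prop :=
  forall q, (forall i, divides q (f i)) -> q \is a GRing.unit.

(* No prime factor of [b] divides every [f i], so each of them divides [c]. *)
Lemma coprime_tuple_dvd (I : Type) (f a : I -> R) n b c :
  prime_length n b -> coprime_tuple f -> (forall i, b * a i = f i * c) ->
  divides b c.
Proof.
move=> bfact f_cop; elim: bfact c => {n b} [u Uu|n q b q_pr bfact IH] c bcE.
  by exists (c / u); rewrite divrK.
have [q_neq0 q_nunit qP] := q_pr.
have [[c' cE]|q_ndvd] := EM (divides q c).
  have [r c'E] : divides b c'.
    apply: IH => i; apply: (mulfI q_neq0).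
    by rewrite mulrA bcE cE [in RHS]mulrCA (mulrC q).
  by exists r; rewrite cE c'E -mulrA (mulrC b).
case/negP: q_nunit; apply: f_cop => i.
have /qP[//|//] : divides q (f i * c).
by rewrite -bcE -mulrA; exists (b * a i); rewrite mulrC.
Qed.

Lemma coprime_tuple_multiple (I : Type) (f a : I -> R) i0 :
  factorial_ring -> coprime_tuple f -> f i0 != 0 ->
  (forall i j, f i * a j = f j * a i) -> exists q, forall i, a i = q * f i.
Proof.
move=> fR f_cop f0 faE; have [n f0fact] := fR _ f0.
have [i|q aE] := coprime_tuple_dvd (a := a) (c := a i0) f0fact f_cop.
  by rewrite faE.
exists q => i; apply: (mulfI f0).
by rewrite faE aE mulrC mulrCA mulrA.
Qed.

Lemma coprime_tuple_exists (I : Type) (w : I -> R) i0 :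
  factorial_ring -> w i0 != 0 ->
  exists q f, coprime_tuple f /\ forall i, w i = q * f i.
Proof.
move=> fR w0; have [n w0fact] := fR _ w0.
elim: n => [|n IH] in w w0 w0fact *; last first.
  have [w_cop|] := EM (coprime_tuple w).
    by exists 1, w; split=> // i; rewrite mul1r.
  move=> /existsNP[q /not_implyP[q_dvd /negP q_nunit]].
  have q_neq0 : q != 0.
    by apply: contraNneq w0 => q0; have [r ->] := q_dvd i0; rewrite q0 mulr0.
  have [m qfact] := fR _ q_neq0.
  have [s s_pr [t qE]] := prime_divisor qfact q_nunit.
  have /choice[v vE] : forall i, exists v, w i = s * v.
    by move=> i; have [r ->] := q_dvd i; exists (r * t); rewrite qE mulrA mulrC.
  have [m' [<-] v0fact] := prime_length_cancel s_pr w0fact (vE i0).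
  have [q' [f [f_cop vfE]]] := IH v (prime_length_neq0 v0fact) v0fact.
  by exists (s * q'), f; split=> // i; rewrite vE vfE mulrA.
exists 1, w; split=> [q q_dvd|i]; last by rewrite mul1r.
exact: divides_unit (prime_length0_unit w0fact) (q_dvd i0).
Qed.

End Divisibility.

Section Transport.
Variables (R S : idomainType) (f : {rmorphism R -> S}) (g : {rmorphism S -> R}).
Hypotheses (fK : cancel f g) (gK : cancel g f).

Let divides_iso a b : divides a (g b) -> divides (f a) b.
Proof. by move=> [r bE]; exists (f r); rewrite -rmorphM /= -bE gK. Qed.

Lemma prime_element_iso q : prime_element q -> prime_element (f q).
Proof.
move=> [q_neq0 q_nunit qP]; split.
- by apply: contraNneq q_neq0 => fq0; rewrite -[q]fK fq0 rmorph0.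
- by apply: contraNN q_nunit => /(rmorph_unit g); rewrite fK.
move=> a b [r abE]; have /qP : divides q (g a * g b).
  by exists (g r); rewrite -rmorphM abE rmorphM fK.
by case=> /divides_iso ?; [left|right].
Qed.

Lemma factorial_ring_iso : factorial_ring R -> factorial_ring S.
Proof.
move=> fR a a_neq0; have /fR[n gafact] : g a != 0.
  by apply: contraNneq a_neq0 => ga0; rewrite -[a]gK ga0 rmorph0.
exists n; rewrite -[a]gK; elim: gafact => {n a a_neq0} [u Uu|n q a q_pr _ IH].
  by apply: prime_length0; rewrite rmorph_unit.
by rewrite rmorphM; apply: prime_lengthS IH; apply: prime_element_iso.
Qed.

End Transport.

Section Gauss.
Variable R : idomainType.
Implicit Types (f g h : {poly R}) (c q : R).

Lemma divides_polyC q f : divides q%:P f <-> forall i, divides q f`_i.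
Proof.
split=> [[g ->] i|/choice[r fE]]; first by exists g`_i; rewrite coefMC.
exists (\poly_(i < size f) r i); apply/polyP => i.
rewrite coefMC coef_poly; case: ltnP => [_|le_fi]; first exact: fE.
by rewrite mul0r nth_default.
Qed.

Lemma first_not_divided q f : (exists i, ~ divides q f`_i) ->
  exists2 i, ~ divides q f`_i & forall j, (j < i)%N -> divides q f`_j.
Proof.
move=> [l fl]; have ex : exists i, `[< ~ divides q f`_i >].
  by exists l; apply/asboolP.
exists (ex_minn ex); case: ex_minnP => i /asboolP fi mini // j lt_ji.
apply: contrapT => fj; suff : (i <= j)%N by rewrite leqNgt lt_ji.
by apply: mini; apply/asboolP.
Qed.

Lemma prime_element_polyC q : prime_element q -> prime_element q%:P.
Proof.
move=> [q_neq0 q_nunit qP]; split.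
- by rewrite polyC_eq0.
- by rewrite poly_unitE coefC size_polyC q_neq0.
move=> f g; rewrite !divides_polyC => fg_dvd; apply: contrapT.
move=> /not_orP[/existsNP fex /existsNP gex].
have [i fi f_dvd] := first_not_divided fex.
have [j gj g_dvd] := first_not_divided gex.
have div_sub a b : divides q (a + b) -> divides q b -> divides q a.
  move=> [r abE] [s bE]; exists (r - s).
  by rewrite mulrBl -abE -bE addrK.
suff /qP[] : divides q (f`_i * g`_j) by [].
have := fg_dvd (i + j)%N; rewrite coefM.
have lt_i : (i < (i + j).+1)%N by rewrite ltnS leq_addr.
rewrite (bigD1 (Ordinal lt_i)) //= addKn => /div_sub; apply.
apply: big_rec => [|l x]; first by exists 0; rewrite mul0r.
rewrite -val_eqE /= => ne_li; apply: dividesD.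
case: (ltngtP l i) => [lt_li|lt_il|eq_li]; last by rewrite eq_li eqxx in ne_li.
  by apply: dividesMr; apply: f_dvd.
apply: dividesMl; apply: g_dvd.
by have := ltn_ord l; rewrite ltnS => le_l; rewrite ltn_subLR // ltn_add2r.
Qed.

Definition primitive f : Prop := forall q, prime_element q -> ~ divides q%:P f.

Lemma Gauss_cancel n c f g h : prime_length n c -> primitive f ->
  c%:P * h = g * f -> divides f h.
Proof.
move=> cfact f_prim; elim: cfact g => {n c} [u Uu|n q c q_pr _ IH] g.
  move=> uhE; exists (u^-1%:P * g); rewrite -mulrA -uhE mulrA -polyCM.
  by rewrite mulVr // mul1r.
rewrite polyCM -mulrA => qhE; have [_ _ qP] := prime_element_polyC q_pr.
have /qP[[g' gE]|/f_prim[//]] : divides q%:P (g * f).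
  by rewrite -qhE; exists (c%:P * h); rewrite mulrC.
apply: (IH g'); apply: (mulfI (x := q%:P)).
  by rewrite polyC_eq0; case: q_pr.
by rewrite qhE gE mulrCA mulrA.
Qed.

Lemma Gauss_split n c f g h : prime_length n c -> c%:P * f = g * h ->
  exists g' h', [/\ f = g' * h', size g' = size g & size h' = size h].
Proof.
move=> cfact; elim: cfact g h => {n c} [u Uu|n q c q_pr _ IH] g h.
  move=> uE; exists (u^-1 *: g), h; split=> //.
    by rewrite -scalerAl -uE mul_polyC scalerA mulVr // scale1r.
  by rewrite size_scale // invr_eq0; apply: contraTneq Uu => ->; rewrite unitr0.
rewrite polyCM -mulrA => qE; have [_ _ qP] := prime_element_polyC q_pr.
have q_neq0 : q != 0 by case: q_pr.
have qP_neq0 : q%:P != 0 by rewrite polyC_eq0.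
have /qP[[g' gE]|[h' hE]] : divides q%:P (g * h).
- by rewrite -qE; exists (c%:P * f); rewrite mulrC.
- have -> : size g = size g' by rewrite gE mulrC mul_polyC size_scale.
  by apply: IH; apply: (mulfI qP_neq0); rewrite qE gE mulrCA mulrA.
have -> : size h = size h' by rewrite hE mulrC mul_polyC size_scale.
by apply: IH; apply: (mulfI qP_neq0); rewrite qE hE mulrA mulrC.
Qed.

Hypothesis fR : factorial_ring R.

Lemma primitive_part f : f != 0 ->
  exists n c f0, [/\ prime_length n c, primitive f0 & f = c%:P * f0].
Proof.
rewrite -lead_coef_eq0 => /fR[m]; elim: m f => [|m IH] f lcfact.
  exists 0, 1, f; split; last by rewrite mul1r.
    exact/prime_length0/unitr1.
  move=> q q_pr /divides_polyC/(_ (size f).-1); rewrite -lead_coefE.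
  move/(divides_unit (prime_length0_unit lcfact)); apply/negP.
  by case: q_pr.
have [f_prim|/existsNP[q /not_implyP[q_pr /contrapT[g fE]]]] := EM (primitive f).
  exists 0, 1, f; split=> //; last by rewrite mul1r.
  exact/prime_length0/unitr1.
have lcE : lead_coef f = q * lead_coef g.
  by rewrite fE lead_coefM lead_coefC mulrC.
have [m' [<-] /IH] := prime_length_cancel q_pr lcfact lcE.
move=> [n [c [f0 [cfact f0_prim gE]]]].
exists n.+1, (q * c), f0; split=> //; first exact: prime_lengthS.
by rewrite polyCM fE gE mulrC mulrA.
Qed.

Lemma prime_length_polyC n c : prime_length n c -> prime_length n c%:P.
Proof.
elim=> {n c} [u Uu|n q c q_pr _ IH].
  by apply: prime_length0; rewrite rmorph_unit.
by rewrite polyCM; apply: prime_lengthS IH; apply: prime_element_polyC.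
Qed.

Lemma primitive_prime_or_split f : primitive f -> (1 < size f)%N ->
  prime_element f \/
  exists g h, [/\ f = g * h, (size g < size f)%N & (size h < size f)%N].
Proof.
move=> f_prim f_gt1; have f_neq0 : f != 0 by rewrite -size_poly_gt0 ltnW.
have [|f_irr] := EM (exists g h,
  [/\ f = g * h, (size g < size f)%N & (size h < size f)%N]); first by right.
left; split=> //; first by rewrite poly_unitE gtn_eqF.
have divP g : Pdiv.Idomain.dvdp f g -> divides f g.
  case/Pdiv.Idomain.dvdpP => -[c r] /= c_neq0; rewrite -mul_polyC => cE.
  by have [n cfact] := fR c_neq0; apply: Gauss_cancel cfact f_prim cE.
move=> g h [r ghE].
pose d := gcdp f g.
have f_ghdvd : Pdiv.Idomain.dvdp f (g * h) by rewrite ghE dvdp_mull.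
have d_neq0 : d != 0 by rewrite gcdp_eq0 negb_and f_neq0.
have [/Pdiv.Idomain.dvdpP[[c s] /= c_neq0 csE]] := dvdp_gcdl f g.
rewrite -/d -mul_polyC in csE.
have s_neq0 : s != 0.
  apply: contraNneq f_neq0 => s0; move/eqP: csE.
  by rewrite s0 mul0r mulf_eq0 polyC_eq0 (negPf c_neq0).
have szE : size f = (size s + size d).-1.
  by rewrite -size_mul // -csE mul_polyC size_scale.
have [n cfact] := fR c_neq0.
have [s' [d' [fE szs szd]]] := Gauss_split cfact csE.
have [d1|d_neq1] := eqVneq (size d) 1%N.
  right; apply: divP; move: f_ghdvd; rewrite Gauss_dvdpr //.
  by rewrite coprimep_def -/d d1.
have [s1|s_neq1] := eqVneq (size s) 1%N.
  left; apply: divP.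
  have df : d %= f.
    by rewrite -dvdp_size_eqp ?dvdp_gcdl // szE s1 eqxx.
  by rewrite -(eqp_dvdl _ df) dvdp_gcdr.
case: f_irr; exists s', d'; split=> //.
  rewrite szs szE; move: d_neq0 d_neq1; rewrite -size_poly_eq0.
  by case: (size d) => [|[|m]] // _ _; rewrite !addnS ltnS leq_addr.
rewrite szd szE; move: s_neq0 s_neq1; rewrite -size_poly_eq0.
by case: (size s) => [|[|m]] // _ _; rewrite !addSn ltnS leq_addl.
Qed.

Lemma factorial_poly : factorial_ring {poly R}.
Proof.
move=> f; have [m le_fm] := ubnP (size f); elim: m => // m IH in f le_fm *.
move=> f_neq0; have [n [c [f0 [cfact f0_prim fE]]]] := primitive_part f_neq0.
suff [n' f0fact] : exists n', prime_length n' f0.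
  exists (n + n')%N; rewrite fE; apply: prime_lengthM => //.
  exact: prime_length_polyC.
have c_neq0 := prime_length_neq0 cfact.
have f0_neq0 : f0 != 0 by apply: contraNneq f_neq0 => f00; rewrite fE f00 mulr0.
have szf0 : size f = size f0 by rewrite fE mul_polyC size_scale.
have [f0_gt1|f0_le1] := ltnP 1 (size f0).
  have [f0_pr|[g [h [f0E szg szh]]]] := primitive_prime_or_split f0_prim f0_gt1.
    exists 1%N; rewrite -[f0]mulr1; apply: prime_lengthS => //.
    exact/prime_length0/unitr1.
  have /andP[g_neq0 h_neq0] : (g != 0) && (h != 0).
    by rewrite -negb_or -mulf_eq0 -f0E.
  have [|a gfact] := IH g _ g_neq0.
    by rewrite -ltnS (leq_trans _ le_fm) // ltnS szf0.
  have [|b hfact] := IH h _ h_neq0.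
    by rewrite -ltnS (leq_trans _ le_fm) // ltnS szf0.
  by exists (a + b)%N; rewrite f0E; apply: prime_lengthM.
have f0C := size1_polyC f0_le1.
have /fR[n' f0fact] : f0`_0 != 0 by rewrite -polyC_eq0 -f0C.
by exists n'; rewrite f0C; apply: prime_length_polyC.
Qed.

End Gauss.

Section MpolyFactorial.
Variable k : fieldType.

Lemma mpoly_rmorphism_ext (n : nat) (S : pzRingType)
    (f g : {rmorphism {mpoly k[n]} -> S}) :
  (forall c, f c%:MP = g c%:MP) -> (forall i, f 'X_i = g 'X_i) -> f =1 g.
Proof.
move=> fgC fgX p; rewrite [p]mpolyE !rmorph_sum; apply: eq_bigr => m _ /=.
rewrite -mul_mpolyC !rmorphM /= fgC mpolyXE_id !rmorph_prod /=; congr (_ * _).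
by apply: eq_bigr => i _; rewrite !rmorphXn /= fgX.
Qed.

Section Step.
Variable n : nat.

Let mwidenr : {rmorphism {mpoly k[n]} -> {mpoly k[n.+1]}} := @mwiden n k.

Let cX : commr_rmorph mwidenr 'X_ord_max.
Proof. by move=> c; exact: mulrC. Qed.

Definition mpoly_of_poly : {rmorphism {poly {mpoly k[n]}} -> {mpoly k[n.+1]}} :=
  horner_morph cX.

Let poly_of_mpoly : {rmorphism {mpoly k[n.+1]} -> {poly {mpoly k[n]}}} :=
  @muni n k.

Let muniX_max : muni ('X_ord_max : {mpoly k[n.+1]}) = 'X.
Proof.
rewrite muniE msuppX big_seq1 mcoeffX eqxx scale1r mnm1E eqxx.
suff -> : [multinom U_(ord_max : 'I_n.+1)%MM (widen_ord (leqnSn n) i) | i < n]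
    = 0%MM.
  by rewrite mpolyX0 scale1r.
apply/mnmP => j; rewrite mnmE mnm1E mnm0E.
by case: eqP => // /(congr1 val) /= jn; move: (ltn_ord j); rewrite -jn ltnn.
Qed.

Let muniX_widen (j : 'I_n) :
  muni ('X_(widen_ord (leqnSn n) j) : {mpoly k[n.+1]}) = ('X_j)%:P.
Proof.
rewrite muniE msuppX big_seq1 mcoeffX eqxx scale1r mnm1E.
have /negPf-> : widen_ord (leqnSn n) j != ord_max.
  by rewrite -val_eqE /= ltn_eqF.
rewrite expr0 alg_polyC; congr ('X_[_])%:P.
by apply/mnmP => l; rewrite mnmE !mnm1E -!val_eqE.
Qed.

Let widenX (j : 'I_n) :
  mwiden ('X_j : {mpoly k[n]}) = 'X_(widen_ord (leqnSn n) j).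
Proof. by rewrite mwidenX mnmwiden1. Qed.

Let ord_case (i : 'I_n.+1) : i = ord_max \/ exists j, i = widen_ord (leqnSn n) j.
Proof.
case: (unliftP ord_max i) => [j ->|]; [right; exists j|by left].
exact/val_inj/lift_max.
Qed.

Let poly_of_mpolyK : cancel poly_of_mpoly mpoly_of_poly.
Proof.
apply: (@mpoly_rmorphism_ext _ _ (mpoly_of_poly \o poly_of_mpoly) idfun)
  => [c|i] /=.
  by rewrite muniC /= horner_morphC /= mwidenC.
have [->|[j ->]] := ord_case i; first by rewrite muniX_max horner_morphX.
by rewrite muniX_widen horner_morphC /= widenX.
Qed.

Let muni_mwiden (q : {mpoly k[n]}) : muni (mwiden q) = q%:P.
Proof.
apply: (@mpoly_rmorphism_ext _ _ (poly_of_mpoly \o mwidenr) polyC) => [c|i] /=.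
  by rewrite mwidenC muniC.
by rewrite widenX muniX_widen.
Qed.

Let mpoly_of_polyK : cancel mpoly_of_poly poly_of_mpoly.
Proof.
elim/poly_ind => [|q c IH]; first by rewrite !rmorph0.
rewrite !rmorphD !rmorphM /= horner_morphX horner_morphC /= muniX_max.
by rewrite muni_mwiden; congr (_ * _ + _).
Qed.

Lemma factorial_mpolyS :
  factorial_ring {mpoly k[n]} -> factorial_ring {mpoly k[n.+1]}.
Proof.
move=> fR; apply: (factorial_ring_iso mpoly_of_polyK poly_of_mpolyK).
exact: factorial_poly.
Qed.

Lemma meval_mwiden (v : 'I_n.+1 -> k) (q : {mpoly k[n]}) :
  (mwiden q).@[v] = q.@[fun i => v (widen_ord (leqnSn n) i)].
Proof.
apply: (@mpoly_rmorphism_ext _ _ (meval v \o mwidenr)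
  (meval (fun i => v (widen_ord (leqnSn n) i)))) => [c|i] /=.
  by rewrite mwidenC !mevalC.
by rewrite widenX !mevalXU.
Qed.

Lemma meval_mpoly_of_poly (v : 'I_n.+1 -> k) (P : {poly {mpoly k[n]}}) :
  (mpoly_of_poly P).@[v]
    = (map_poly (meval (fun i => v (widen_ord (leqnSn n) i))) P).[v ord_max].
Proof.
elim/poly_ind: P => [|P c IH]; first by rewrite !rmorph0 horner0.
rewrite !rmorphD !rmorphM /= IH horner_morphX horner_morphC /= mevalXU.
by rewrite meval_mwiden map_polyX map_polyC hornerMXaddC.
Qed.

Lemma mpoly_eval_eq0S :
  (forall p : {poly k}, p != 0 -> exists t, ~~ root p t) ->
  (forall f : {mpoly k[n]}, (forall v, f.@[v] = 0) -> f = 0) ->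
  forall f : {mpoly k[n.+1]}, (forall v, f.@[v] = 0) -> f = 0.
Proof.
move=> k_inf IH f f0; rewrite -[f]poly_of_mpolyK; set P := poly_of_mpoly f.
suff -> : P = 0 by rewrite rmorph0.
apply/polyP => i; rewrite coef0; apply: IH => v.
have P0 : map_poly (meval v) P = 0.
  apply: contrapT => /eqP/k_inf[t /negP[]]; rewrite rootE; apply/eqP.
  pose v' (l : 'I_n.+1) := oapp v t (unlift ord_max l).
  have <- : v' ord_max = t by rewrite /v' unlift_none.
  have -> : meval v = meval (fun i => v' (widen_ord (leqnSn n) i)).
    congr meval; apply: funext => l; rewrite /v'.
    have -> : widen_ord (leqnSn n) l = lift ord_max l.
      by apply/val_inj/esym/lift_max.
    by rewrite liftK.
  by rewrite -meval_mpoly_of_poly poly_of_mpolyK.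
by rewrite -coef_map P0 coef0.
Qed.

End Step.

Lemma factorial_mpoly n : factorial_ring {mpoly k[n]}.
Proof.
elim: n => [|n IH]; last exact: factorial_mpolyS.
move=> f f_neq0; exists 0; apply: prime_length0.
rewrite [f]nvar0_mpolyC.
move: f_neq0; rewrite {1}[f]nvar0_mpolyC mpolyC_eq0 => f0.
by rewrite rmorph_unit // unitfE.
Qed.

End MpolyFactorial.

Lemma mpoly_eval_eq0 (k : closedFieldType) n (f : {mpoly k[n]}) :
  (forall v, f.@[v] = 0) -> f = 0.
Proof.
elim: n f => [|n IH] f; last first.
  by apply: mpoly_eval_eq0S IH f => p /closed_nonrootP.
rewrite [f]nvar0_mpolyC => /(_ (fun=> 0)).
by rewrite mevalC => ->; rewrite mpolyC0.
Qed.

Lemma poly_monomial_factor (R : idomainType) (P Q : {poly R}) (c : R) D :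
  c != 0 -> P * Q = c *: 'X^D -> exists a e, P = a *: 'X^e.
Proof.
move=> c_neq0 PQE; have PQ0 : P * Q != 0.
  by rewrite PQE scale_poly_eq0 negb_or c_neq0 -size_poly_eq0 size_polyXn.
have [P0 Q0] : P != 0 /\ Q != 0 by apply/andP; rewrite -negb_or -mulf_eq0.
have [a [P']] := multiplicity_XsubC P 0; rewrite P0 /= subr0 => P'0 PE.
have [b [Q']] := multiplicity_XsubC Q 0; rewrite Q0 /= subr0 => Q'0 QE.
have PQ'E : P' * Q' * 'X^(a + b) = c *: 'X^D.
  by rewrite -PQE PE QE exprD mulrACA.
have PQ'0 : (P' * Q').[0] != 0 by rewrite hornerM mulf_neq0.
have XnI m : injective (fun f : {poly R} => f * 'X^m).
  by move=> f g; apply: mulIf; rewrite -size_poly_eq0 size_polyXn.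
have [lt_D|lt_ab|eq_D] := ltngtP (a + b)%N D.
- have PQ'D : P' * Q' = c *: 'X^(D - (a + b)).
    apply: (XnI (a + b)%N).
    by rewrite PQ'E -scalerAl -exprD subnK // ltnW.
  move: PQ'0; rewrite PQ'D.
  by rewrite hornerZ hornerXn expr0n subn_eq0 leqNgt lt_D mulr0 eqxx.
- have /(congr1 (horner^~ 0)) : P' * Q' * 'X^(a + b - D) = c%:P.
    apply: (XnI D); rewrite /= -[LHS]mulrA -exprD subnK ?PQ'E ?mul_polyC //.
    exact: ltnW.
  rewrite /= hornerM hornerXn expr0n subn_eq0 leqNgt lt_ab mulr0 hornerC.
  by move/esym/eqP; rewrite (negPf c_neq0).
have /(congr1 (fun f : {poly R} => size f)) : P' * Q' = c%:P.
  by apply: (XnI D); rewrite mul_polyC -PQ'E eq_D.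
have P'_neq0 : P' != 0 by apply: contraNneq P0 => P'0'; rewrite PE P'0' mul0r.
have Q'_neq0 : Q' != 0 by apply: contraNneq Q0 => Q'0'; rewrite QE Q'0' mul0r.
rewrite size_mul // size_polyC c_neq0.
move: (P'_neq0) (Q'_neq0); rewrite -!size_poly_gt0 => szP szQ szPQ.
have /size1_polyC P'C : (size P' <= 1)%N.
  move: szPQ szP szQ; case: (size P') => [|[|m]] //.
  by case: (size Q') => [|l] //; rewrite !addSn !addnS.
by exists P'`_0, a; rewrite -mul_polyC -P'C.
Qed.

Section Homogeneous.
Variables (k : fieldType) (n : nat).
Implicit Types (p q : {mpoly k[n]}).

Local Notation "d .-homog" := (@ishomog1 n k d mdeg)
  (at level 1, format "d .-homog") : form_scope.

(* [p(t X_1, ..., t X_n)] as a polynomial in [t]. *)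
Definition homogenizer : {mpoly k[n]} -> {poly {mpoly k[n]}} :=
  mmap (polyC \o @mpolyC n k) (fun i => 'X_i *: 'X).

HB.instance Definition _ := GRing.RMorphism.on homogenizer.

Lemma homogenizerX m : homogenizer 'X_[m] = 'X_[m] *: 'X^(mdeg m).
Proof.
rewrite /homogenizer mmapX /mmap1.
under eq_bigr do rewrite -mul_polyC exprMn.
rewrite big_split /= prodrXr mdegE -mul_polyC mpolyXE_id rmorph_prod /=.
by congr (_ * _); apply: eq_bigr => i _; rewrite rmorphXn.
Qed.

Lemma coef_homogenizer p d : (homogenizer p)`_d = pihomog mdeg d p.
Proof.
rewrite {1}[p]mpolyE raddf_sum coef_sum pihomogE [RHS]big_mkcond /=.
apply: eq_bigr => m _; rewrite -mul_mpolyC rmorphM /= homogenizerX.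
rewrite /homogenizer mmapC /= coefCM coefZ coefXn mulrA mul_mpolyC eq_sym.
by case: eqP => _; rewrite ?mulr1 ?mulr0.
Qed.

Lemma homogenizer_homog d p : p \is d.-homog -> homogenizer p = p *: 'X^d.
Proof.
move=> hp; apply/polyP => i; rewrite coef_homogenizer coefZ coefXn.
have [->|ne_id] := eqVneq i d; first by rewrite mulr1 pihomog_dE.
by rewrite mulr0 (pihomog_ne0 _ hp) // eq_sym.
Qed.

Lemma homogenizer1 p : (homogenizer p).[1] = p.
Proof.
rewrite horner_coef.
pose m := maxn (size (homogenizer p)) (msize p).
transitivity (\sum_(i < m) pihomog mdeg i p); last first.
  by rewrite -pihomog_partitionE // leq_maxr.
rewrite (big_ord_widen m (fun i => (homogenizer p)`_i * 1 ^+ i)) ?leq_maxl //.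
rewrite big_mkcond /=; apply: eq_bigr => i _; rewrite expr1n mulr1.
case: ltnP => [_|le_i]; first by rewrite coef_homogenizer.
by rewrite -coef_homogenizer nth_default.
Qed.

Lemma homog_factor D p q : p * q != 0 -> p * q \is D.-homog ->
  exists d, p \is d.-homog.
Proof.
move=> pq0 /homogenizer_homog; rewrite rmorphM /= => /(poly_monomial_factor pq0).
move=> [a [e pE]]; exists e; rewrite homog_piE -coef_homogenizer.
rewrite -{2}[p]homogenizer1 pE coefZ coefXn eqxx mulr1.
by rewrite hornerZ hornerXn expr1n mulr1.
Qed.

End Homogeneous.

(** * Morphisms given by forms *)

Section TopCoefficient.
Variable R : comNzRingType.
Implicit Types (p q : {poly R}) (a b : R).

Definition top_coef d a p : Prop := (size p <= d.+1)%N /\ p`_d = a.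

Lemma top_coefM d e a b p q :
  top_coef d a p -> top_coef e b q -> top_coef (d + e) (a * b) (p * q).
Proof.
move=> [szp <-] [szq <-]; split.
  apply: leq_trans (size_polyMleq p q) _.
  by rewrite -subn1 leq_subLR add1n -addSn -addnS leq_add.
have lt_d : (d < (d + e).+1)%N by rewrite ltnS leq_addr.
rewrite coefM (bigD1 (Ordinal lt_d)) //= addKn big1 ?addr0 // => i.
rewrite -val_eqE /= neq_ltn => /orP[lt_id|lt_di]; last first.
  by rewrite nth_default ?mul0r // (leq_trans szp).
by rewrite [q`_ _]nth_default ?mulr0 // (leq_trans szq) // ltn_subRL ltn_add2r.
Qed.

Lemma top_coefX d a p n : top_coef d a p -> top_coef (d * n) (a ^+ n) (p ^+ n).
Proof.
move=> pd; elim: n => [|n IH].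
  by rewrite muln0 !expr0; split; rewrite ?size_poly1 // coef1 eqxx.
by rewrite mulnS !exprS; apply: top_coefM.
Qed.

Lemma top_coef_prod (I : Type) (r : seq I) (d : I -> nat) (a : I -> R)
    (p : I -> {poly R}) :
  (forall i, top_coef (d i) (a i) (p i)) ->
  top_coef (\sum_(i <- r) d i) (\prod_(i <- r) a i) (\prod_(i <- r) p i).
Proof.
move=> pd; elim: r => [|i r IH]; last by rewrite !big_cons; apply: top_coefM.
by rewrite !big_nil; split; rewrite ?size_poly1 // coef1 eqxx.
Qed.

Lemma top_coefZ d a p c : top_coef d a p -> top_coef d (c * a) (c *: p).
Proof.
by move=> [szp <-]; split; rewrite ?coefZ // (leq_trans (size_scale_leq c p)).
Qed.

Lemma top_coef_sum d (I : eqType) (r : seq I) (a : I -> R) (p : I -> {poly R}) :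
  (forall i, i \in r -> top_coef d (a i) (p i)) ->
  top_coef d (\sum_(i <- r) a i) (\sum_(i <- r) p i).
Proof.
elim: r => [_|i r IH pd].
  by rewrite !big_nil; split; rewrite ?size_poly0 // coef0.
have [szp pa] := pd i (mem_head _ _).
have [|szs sa] := IH; first by move=> j rj; apply: pd; rewrite inE rj orbT.
rewrite !big_cons; split; last by rewrite coefD pa sa.
by rewrite (leq_trans (size_polyD _ _)) // geq_max szp.
Qed.

End TopCoefficient.

Lemma homog_prod_ord (k : fieldType) n m (F : 'I_m -> {mpoly k[n]})
    (d : 'I_m -> nat) :
  (forall i, F i \is (d i).-homog) -> \prod_i F i \is (\sum_i d i).-homog.
Proof.
move=> Fh; apply: (big_ind2 (fun p e => p \is e.-homog)) => //.
  exact: dhomog1.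
by move=> p d1 q d2 hp hq; apply: dhomogM.
Qed.

Lemma homog_comp (k : fieldType) n m (lq : n.-tuple {mpoly k[m]}) d
    (f : {mpoly k[n]}) :
  (forall i, tnth lq i \is 1.-homog) -> f \is d.-homog -> f \mPo lq \is d.-homog.
Proof.
move=> lq1 /dhomogP fh; rewrite comp_mpolyEX big_seq; apply: rpred_sum => mm fmm.
apply: rpredZ; rewrite comp_mpolyX -(fh _ fmm) /= mdegE.
by apply: homog_prod_ord => i; rewrite -[X in X.-homog]mul1n; apply: dhomogMn.
Qed.

Section BinaryZero.
Variables (k : closedFieldType) (n : nat) (u v : 'I_n -> k).

Lemma homog_line_zero d (f : {mpoly k[n]}) : (0 < d)%N -> f \is d.-homog ->
  f.@[v] = 0 \/ exists t, f.@[fun i => u i + t * v i] = 0.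
Proof.
move=> d_gt0 /dhomogP fh.
pose h i : {poly k} := (u i)%:P + v i *: 'X.
pose r : {poly k} := mmap polyC h f.
have hT i : top_coef 1 (v i) (h i).
  split; last by rewrite coefD coefC coefZ coefX add0r mulr1.
  rewrite (leq_trans (size_polyD _ _)) // geq_max size_polyC.
  by rewrite (leq_trans (size_scale_leq _ _)) ?size_polyX // andbT; case: eqP.
have [_ rd] : top_coef d f.@[v] r.
  rewrite mevalE /r /mmap; apply: top_coef_sum => m fm.
  rewrite mul_polyC; apply: top_coefZ; rewrite -(fh _ fm) /= mdegE.
  apply: top_coef_prod => i; rewrite -[X in top_coef X]mul1n.
  exact: top_coefX.
have rE t : r.[t] = f.@[fun i => u i + t * v i].
  apply: (@mpoly_rmorphism_ext _ _ _ (horner_eval t \o mmap polyC h)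
    (meval (fun i => u i + t * v i))) => [c|i] /=.
    by rewrite mmapC mevalC /horner_eval hornerC.
  by rewrite mmapX mmap1U mevalXU /horner_eval /h !hornerE mulrC.
have [r1|/closed_rootP[t rt]] := eqVneq (size r) 1%N.
  by left; rewrite -rd nth_default // r1.
by right; exists t; rewrite -rE; apply/rootP.
Qed.

End BinaryZero.

Section PolynomialMaps.
Variable k : closedFieldType.

Definition peval (W : vectType k) (f : {mpoly k[\dim {:W}]}) (x : W) : k :=
  f.@[fun l => coord (vbasis {:W}) l x].

Definition pmap_eval (W E : vectType k)
    (f : 'I_(\dim {:E}) -> {mpoly k[\dim {:W}]}) (x : W) : E :=
  \sum_i peval (f i) x *: (vbasis {:E})`_i.

Section One.
Variables (W E : vectType k).
Implicit Types (q : {mpoly k[\dim {:W}]}).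
Implicit Types (f w : 'I_(\dim {:E}) -> {mpoly k[\dim {:W}]}).

Lemma peval_coords q (v : 'I_(\dim {:W}) -> k) :
  q.@[v] = peval q (\sum_l v l *: (vbasis {:W})`_l).
Proof.
rewrite /peval; congr meval; apply: funext => l.
by rewrite coord_sum_free // (basis_free (vbasisP _)).
Qed.

Lemma coord_pmap_eval f x i :
  coord (vbasis {:E}) i (pmap_eval f x) = peval (f i) x.
Proof. by rewrite coord_sum_free // (basis_free (vbasisP _)). Qed.

Lemma pmap_eval_neq0 f x : pmap_eval f x != 0 -> exists i, peval (f i) x != 0.
Proof.
apply: contra_neqP => /forallNP f0; apply: big1 => i _.
by have /negP/negbNE/eqP-> := f0 i; rewrite scale0r.
Qed.

Lemma exists_neq0 : (0 < \dim {:W})%N -> exists x : W, x != 0.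
Proof.
move=> W_gt0; exists (vbasis {:W})`_(Ordinal W_gt0).
apply: free_not0 (basis_free (vbasisP {:W})) _.
by rewrite mem_nth // size_tuple.
Qed.

Lemma peval_eq0 q : (0 < \dim {:W})%N ->
  (forall x : W, x != 0 -> peval q x = 0) -> q = 0.
Proof.
move=> W_gt0 q0; pose l0 := Ordinal W_gt0.
have : 'X_l0 * q = 0.
  apply: mpoly_eval_eq0 => v; rewrite peval_coords /peval mevalM mevalXU.
  set x := \sum_l _; have [->|/q0 qx] := eqVneq x 0.
    by rewrite linear0 mul0r.
  by rewrite [X in _ * X]qx mulr0.
move/eqP; rewrite mulf_eq0 => /orP[/eqP X0|/eqP//].
have := @msizeX _ k U_(l0)%MM.
by rewrite X0 msize0.
Qed.

Lemma peval_neq0 q (x : W) : peval q x != 0 -> q != 0.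
Proof. by apply: contraNneq => ->; rewrite /peval meval0. Qed.

Lemma same_line_minors (y z : E) (l : {vspace E}) i j :
  y = 0 \/ l = <[y]>%VS -> z = 0 \/ l = <[z]>%VS ->
  coord (vbasis {:E}) i y * coord (vbasis {:E}) j z
    = coord (vbasis {:E}) j y * coord (vbasis {:E}) i z.
Proof.
case=> [->|ly]; first by rewrite !linear0 !mul0r.
case=> [->|lz]; first by rewrite !linear0 !mulr0.
have /vlineP[c ->] : y \in <[z]>%VS by rewrite -lz ly memv_line.
by rewrite !linearZ /= -!mulrA; congr (_ * _); rewrite mulrC.
Qed.

Lemma proportional_maps f w (phi : W -> {vspace E}) : (0 < \dim {:W})%N ->
  (forall x : W, x != 0 -> pmap_eval f x = 0 \/ phi x = <[pmap_eval f x]>%VS) ->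
  (forall x : W, x != 0 -> pmap_eval w x = 0 \/ phi x = <[pmap_eval w x]>%VS) ->
  forall i j, f i * w j = f j * w i.
Proof.
move=> W_gt0 fphi wphi i j; apply/eqP; rewrite -subr_eq0; apply/eqP.
apply: (peval_eq0 W_gt0) => x x_neq0.
rewrite /peval mevalB !mevalM -!/(peval _ _) -!coord_pmap_eval.
by rewrite (same_line_minors i j (fphi x x_neq0) (wphi x x_neq0)) subrr.
Qed.

Variables (U : set W) (phi : W -> {vspace E}).
Hypotheses (W_gt0 : (0 < \dim {:W})%N) (UW : forall x : W, x != 0 -> U x).

Lemma represents_morphismE d f : represents_morphism U phi d f <->
  [/\ forall i, f i \is d.-homog, coprime_tuple f
    & forall x, x != 0 -> pmap_eval f x != 0 /\ phi x = <[pmap_eval f x]>%VS].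
Proof.
split=> [[fh fc fphi]|[fh fc fphi]]; split=> // x x_neq0.
  by apply: fphi => //; apply: UW.
by move=> _; apply: fphi.
Qed.

Lemma represents_morphism_leq d f d' f' :
  represents_morphism U phi d f -> represents_morphism U phi d' f' -> (d <= d')%N.
Proof.
move=> /represents_morphismE[fh fc fphi] /represents_morphismE[f'h f'c f'phi].
have [x0 x0_neq0] := exists_neq0 W_gt0.
have [/pmap_eval_neq0[i0 /peval_neq0 fi0] _] := fphi _ x0_neq0.
have [/pmap_eval_neq0[i1 /peval_neq0 f'i1] _] := f'phi _ x0_neq0.
have [|q f'E] := coprime_tuple_multiple (a := f') (@factorial_mpoly _ _) fc fi0.
  apply: (proportional_maps (phi := phi)) => // x x_neq0.
    by right; case: (fphi x x_neq0).
  by right; case: (f'phi x x_neq0).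
have q_neq0 : q != 0 by apply: contraNneq f'i1 => q0; rewrite f'E q0 mul0r.
have szd (p : {mpoly k[\dim {:W}]}) e :
    p != 0 -> p \is e.-homog -> msize p = e.+1.
  move=> p0 /dhomogP pe; rewrite -mlead_deg //.
  by rewrite (pe _ (mlead_supp p0)).
have f'i0 : f' i0 != 0 by rewrite f'E mulf_neq0.
have := szd _ _ f'i0 (f'h i0); rewrite f'E msizeM // (szd _ _ fi0 (fh i0)).
rewrite addnS /= => szE; rewrite -ltnS -szE -[X in (X < _)%N]add0n ltn_add2r.
by rewrite lt0n msize_poly_eq0.
Qed.

Lemma morphism_degreeP d f :
  represents_morphism U phi d f -> morphism_degree U phi = d.
Proof.
move=> fd; rewrite /morphism_degree.
have [f' f'd] := @xgetPex _ 0%N [set d | exists f, represents_morphism U phi d f]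
  (ex_intro _ d (ex_intro _ f fd)).
apply/eqP; rewrite eqn_leq.
by rewrite (represents_morphism_leq f'd fd) (represents_morphism_leq fd f'd).
Qed.

(* Dividing one of the [w s] by its greatest common divisor gives a family [f]  *)
(* of which every [w s] is a multiple, so [f] vanishes nowhere.                 *)
Lemma represents_morphism_glue (I : Type) D
    (w : I -> 'I_(\dim {:E}) -> {mpoly k[\dim {:W}]}) :
  (forall s i, w s i \is D.-homog) ->
  (forall x, x != 0 -> exists s, pmap_eval (w s) x != 0) ->
  (forall x s, x != 0 -> pmap_eval (w s) x != 0 ->
     phi x = <[pmap_eval (w s) x]>%VS) ->
  exists d f, represents_morphism U phi d f.
Proof.
move=> wh wcover wphi.
have [x0 x0_neq0] := exists_neq0 W_gt0.
have [s0 /pmap_eval_neq0[i0 /peval_neq0 w0_neq0]] := wcover _ x0_neq0.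
have [q [f [fc wE]]] := coprime_tuple_exists (@factorial_mpoly _ _) w0_neq0.
have /andP[q_neq0 f0_neq0] : (q != 0) && (f i0 != 0).
  by rewrite -negb_or -mulf_eq0 -wE.
have wline s x : x != 0 ->
    pmap_eval (w s) x = 0 \/ phi x = <[pmap_eval (w s) x]>%VS.
  move=> x_neq0; have [|/wphi] := eqVneq (pmap_eval (w s) x) 0; first by left.
  by right; auto.
have fmul s : exists r, forall i, w s i = r * f i.
  apply: coprime_tuple_multiple (@factorial_mpoly _ _) fc f0_neq0 _ => i j.
  apply: (mulfI q_neq0); rewrite !mulrA -!wE.
  exact: (proportional_maps W_gt0 (wline s0) (wline s)).
have [e qe] : exists e, q \is e.-homog.
  by apply: (@homog_factor _ _ D q (f i0)); rewrite -wE.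
exists (D - e)%N, f; apply/represents_morphismE; split=> // [i|x x_neq0].
  have [->|fi_neq0] := eqVneq (f i) 0; first exact: dhomog0.
  have qf_neq0 : q * f i != 0 by rewrite mulf_neq0.
  have qfD : q * f i \is D.-homog by rewrite -wE.
  have [d fd] : exists d, f i \is d.-homog.
    by apply: (@homog_factor _ _ D (f i) q); rewrite mulrC.
  by rewrite (dhomog_uniq qf_neq0 qfD (dhomogM qe fd)) addKn.
have [s wsx] := wcover x x_neq0; have [r rE] := fmul s.
have wsE : pmap_eval (w s) x = peval r x *: pmap_eval f x.
  rewrite /pmap_eval scaler_sumr; apply: eq_bigr => i _.
  by rewrite rE /peval mevalM scalerA.
have rx : peval r x != 0 by apply: contraNneq wsx => rx0; rewrite wsE rx0 scale0r.
split; first by apply: contraNneq wsx => fx0; rewrite wsE fx0 scaler0.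
rewrite (wphi x s) // wsE; apply/eqP; rewrite eqEsubv -!memvE.
rewrite memvZ ?memv_line //=; apply/vlineP; exists (peval r x)^-1.
by rewrite scalerA mulVf // scale1r.
Qed.

End One.

Lemma homog_nowhere_zero (W : vectType k) d (q : {mpoly k[\dim {:W}]}) :
  (1 < \dim {:W})%N -> q \is d.-homog ->
  (forall x : W, x != 0 -> peval q x != 0) ->
  q \is a GRing.unit.
Proof.
move=> W_gt1 qd qx; have W_gt0 := ltnW W_gt1.
have [x0 x0_neq0] := exists_neq0 W_gt0.
have q_neq0 := peval_neq0 (qx _ x0_neq0).
have [d0|d_gt0] := posnP d.
  have q1 : (msize q <= 1)%N.
    move: qd; rewrite d0 => /dhomogP q0.
    by rewrite -mlead_deg // (q0 _ (mlead_supp q_neq0)).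
  have qC := msize1_polyC q1; rewrite qC rmorph_unit // unitfE.
  by apply: contraNneq q_neq0 => q00; rewrite qC q00 mpolyC0.
pose i0 := Ordinal W_gt0; pose i1 := Ordinal W_gt1.
have qv (v : 'I_(\dim {:W}) -> k) l : v l != 0 -> q.@[v] != 0.
  move=> vl; rewrite peval_coords; apply: qx; apply: contraNneq vl => x0E.
  have := coord_sum_free v l (basis_free (vbasisP {:W})).
  by rewrite x0E linear0 => <-.
have [/eqP|[t /eqP]] := homog_line_zero
  (fun i => (i == i0)%:R) (fun i => (i == i1)%:R) d_gt0 qd.
  by rewrite (negPf (qv _ i1 _)) // eqxx oner_neq0.
by rewrite (negPf (qv _ i0 _)) // eqxx mulr0 addr0 oner_neq0.
Qed.

Section Restriction.
Variables (W W' E : vectType k) (iota : {linear W' -> W}).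
Variables (U : set W) (U' : set W').
Variables (phi : W -> {vspace E}) (phi' : W' -> {vspace E}).
Hypotheses (iota_inj : forall x : W', x != 0 -> iota x != 0)
  (W'_gt1 : (1 < \dim {:W'})%N)
  (UW : forall x : W, x != 0 -> U x) (UW' : forall x : W', x != 0 -> U' x)
  (phiE : forall x : W', x != 0 -> phi' x = phi (iota x)).

Definition restrict_forms : (\dim {:W}).-tuple {mpoly k[\dim {:W'}]} :=
  [tuple \sum_(i < \dim {:W'})
     coord (vbasis {:W}) l (iota (vbasis {:W'})`_i) *: 'X_i | l < \dim {:W}].

Lemma peval_restrict (q : {mpoly k[\dim {:W}]}) x :
  peval (q \mPo restrict_forms) x = peval q (iota x).
Proof.
rewrite /peval comp_mpoly_meval; congr meval; apply: funext => l.
rewrite tnth_mktuple [in RHS](coord_vbasis (memvf x)) raddf_sum !linear_sum /=.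
apply: eq_bigr => i _.
by rewrite mevalZ mevalXU !linearZ /= mulrC.
Qed.

Lemma represents_morphism_restrict d f : represents_morphism U phi d f ->
  represents_morphism U' phi' d (fun i => f i \mPo restrict_forms).
Proof.
move=> /(represents_morphismE _ UW)[fh fc fphi].
apply/(represents_morphismE _ UW').
have f'E x :
    pmap_eval (fun i => f i \mPo restrict_forms) x = pmap_eval f (iota x).
  by apply: eq_bigr => i _; rewrite peval_restrict.
have f'h i : f i \mPo restrict_forms \is d.-homog.
  apply: homog_comp => // l; rewrite tnth_mktuple; apply: rpred_sum => j _.
  by apply: rpredZ; rewrite dhomogX; apply/eqP; exact: mdeg1.
have f'x x : x != 0 -> pmap_eval f (iota x) != 0.
  by move=> x0; case: (fphi _ (iota_inj x0)).
split=> // [q q_dvd|x x0]; last first.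
  by rewrite f'E phiE //; apply: fphi; apply: iota_inj.
have [x0 x0_neq0] := exists_neq0 (ltnW W'_gt1).
have [i0 fi0] := pmap_eval_neq0 (f'x _ x0_neq0).
have [r rE] := q_dvd i0.
have f'i0 : f i0 \mPo restrict_forms != 0.
  by apply: (@peval_neq0 _ _ x0); rewrite peval_restrict.
have [e qe] : exists e, q \is e.-homog.
  by apply: (@homog_factor _ _ d q r); rewrite mulrC -rE.
apply: homog_nowhere_zero W'_gt1 qe _ => x x_neq0.
apply: contraTneq (f'x x x_neq0) => qx0.
rewrite negbK -f'E; apply/eqP/big1 => i _.
have [s ->] := q_dvd i; rewrite /peval mevalM [X in _ * X]qx0.
by rewrite mulr0 scale0r.
Qed.

End Restriction.

End PolynomialMaps.

(** * The image of an operator and its minors *)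

Section Minors.
Variable k : fieldType.

Lemma increasing_minor d n (A : 'M[k]_(d, n)) (t : 'I_d -> 'I_n) :
  \det (colsub t A) != 0 -> injective t ->
  exists s : 'I_d -> 'I_n, (forall i j : 'I_d, (i < j)%N -> (s i < s j)%N) /\
    \det (colsub s A) != 0.
Proof.
move=> tA t_inj; pose T := [set t i | i : 'I_d]%SET.
have cardT : #|T| = d by rewrite card_imset // card_ord.
pose s (i : 'I_d) : 'I_n := Order.enum_val (cast_ord (esym cardT) i).
exists s; split=> [i j lt_ij|].
  suff : (s i < s j)%O by [].
  rewrite Order.POrderTheory.lt_neqAle /s Order.le_enum_val.
    rewrite (inj_eq (@Order.enum_val_inj _ _ _)).
    by rewrite -val_eqE /= neq_ltn lt_ij; apply: ltnW.
  exact: Order.TotalTheory.le_total.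
apply: contraNneq tA => sA0.
have -> : colsub t A = colsub s A *m (\matrix_(i, l) (s i == t l)%:R).
  apply/matrixP => r l; rewrite !mxE.
  have tlT : t l \in T by apply: imset_f.
  pose i0 := cast_ord cardT (Order.enum_rank_in tlT (t l)).
  have si0 : s i0 = t l.
    by rewrite /s cast_ordK Order.enum_rankK_in.
  rewrite (bigD1 i0) //= !mxE si0 eqxx mulr1 big1 ?addr0 // => i ne_i.
  rewrite !mxE -si0; case: eqP => [|_]; last by rewrite mulr0.
  by move=> /Order.enum_val_inj/cast_ord_inj ii0; rewrite ii0 eqxx in ne_i.
by rewrite det_mulmx sA0 mul0r.
Qed.

End Minors.

Section Wedge.
Variables (k : fieldType) (M : vectType k).

Lemma wedge_comb d (C : 'M[k]_d) (v b : 'I_d -> M) :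
  (forall i, v i = \sum_l C i l *: b l) -> wedge v = \det C *: wedge b.
Proof.
move=> vE; apply/ffunP => s; rewrite !ffunE.
apply: (etrans _ (det_mulmx C _)); congr (\det _).
apply/matrixP => i l; rewrite !mxE vE linear_sum; apply: eq_bigr => c _.
by rewrite mxE linearZ.
Qed.

Lemma plucker_wedge d (N : {vspace M}) (v : 'I_d -> M) :
  \dim N = d -> (forall i, v i \in N) -> wedge v != 0 ->
  plucker d N = <[wedge v]>%VS.
Proof.
move=> Nd; subst d => vN.
pose C := \matrix_(i, l) coord (vbasis N) l (v i).
have -> := @wedge_comb _ C v (fun i => (vbasis N)`_i).
  move=> w_neq0; have C_neq0 : \det C != 0.
    by apply: contraNneq w_neq0 => ->; rewrite scale0r.
  apply/eqP; rewrite eqEsubv -!memvE memvZ ?memv_line // andbT.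
  by apply/vlineP; exists (\det C)^-1; rewrite scalerA mulVf // scale1r.
move=> i; rewrite {1}(coord_vbasis (vN i)); apply: eq_bigr => l _.
by rewrite mxE.
Qed.

Lemma exists_wedge_neq0 (f : 'End(M)) d : \dim (limg f) = d ->
  exists I : 'I_d -> 'I_(\dim {:M}),
    wedge (fun i => f (vbasis {:M})`_(I i)) != 0.
Proof.
move=> fd; subst d; set d := \dim _; set e := vbasis {:M}.
have lf (i : 'I_d) : (vbasis (limg f))`_i \in limg f.
  by apply: (basis_mem (vbasisP _)); rewrite mem_nth // size_tuple.
pose u (i : 'I_d) : M := (f^-1)%VF (vbasis (limg f))`_i.
have fu i : f (u i) = (vbasis (limg f))`_i by apply: limg_lfunVK.
pose Z := \matrix_(l < \dim {:M}, c < \dim {:M}) coord e c (f e`_l).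
pose T := \matrix_(i < d, l < \dim {:M}) coord e l (u i).
have TZ i c : (T *m Z) i c = coord e c (vbasis (limg f))`_i.
  rewrite mxE -fu {1}(coord_vbasis (memvf (u i))) !linear_sum.
  by apply: eq_bigr => l _; rewrite !mxE !linearZ.
have TZ_free : row_free (T *m Z).
  apply: inj_row_free => a aTZ.
  have : \sum_i a 0 i *: (vbasis (limg f))`_i = 0.
    rewrite [LHS](coord_vbasis (memvf _)); apply: big1 => c _.
    have /matrixP/(_ 0 c) := aTZ; rewrite !mxE => ac.
    rewrite linear_sum /= (_ : \sum_i _ = 0) ?scale0r // -[RHS]ac.
    by apply: eq_bigr => i _; rewrite linearZ TZ.
  have /freeP fb := basis_free (vbasisP (limg f)); move/fb => a0.
  by apply/rowP => i; rewrite a0 mxE.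
have TZ_full : row_full (T *m Z)^T by rewrite /row_full mxrank_tr.
pose g := fullrankfun TZ_full.
have gTZ : colsub g (T *m Z) \in unitmx.
  by rewrite -unitmx_tr trmx_mxsub; apply: fullrowsub_unit.
have Zg_full : row_full (colsub g Z).
  apply/row_fullP; exists (invmx (colsub g (T *m Z)) *m T).
  by rewrite -mulmxA mulmx_colsub mulVmx.
pose I := fullrankfun Zg_full; exists I.
have IZ : \det (colsub g (rowsub I Z)) != 0.
  rewrite -unitfE -unitmxE.
  suff -> : colsub g (rowsub I Z) = rowsub I (colsub g Z).
    exact: fullrowsub_unit.
  by apply/matrixP => i j; rewrite !mxE.
have [s [s_inc sZ]] := increasing_minor IZ (@fullrankfun_inj _ _ _ _ _).
have s_inc' : [forall i : 'I_d, forall j : 'I_d,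
    (i < j)%N ==> (finfun s i < finfun s j)%N].
  by apply/'forall_forallP => i j; apply/implyP; rewrite !ffunE; apply: s_inc.
apply: contraNneq sZ => /ffunP/(_ (Sub (finfun s) s_inc')).
rewrite !ffunE /= => w0; apply/eqP; rewrite -[RHS]w0; congr (\det _).
by apply/matrixP => i l; rewrite !mxE; congr (coord _ _ _); rewrite ffunE.
Qed.

End Wedge.

Section PowerImages.
Variables (k : closedFieldType) (W M : vectType k).
Variable theta : {linear W -> 'End(M)}.

Local Notation n := (\dim {:M}).
Local Notation e := (vbasis {:M}).

Definition theta_pow x j : 'End(M) := iter j (comp_lfun (theta x)) \1%VF.

Definition theta_mx : 'M[{mpoly k[\dim {:W}]}]_n :=
  \matrix_(i, l) \sum_(t < \dim {:W})
    coord e l (theta (vbasis {:W})`_t e`_i) *: 'X_t.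

Definition theta_pow_mx j : 'M[{mpoly k[\dim {:W}]}]_n :=
  iter j (fun A => A *m theta_mx) 1%:M.

Lemma theta_mxE x i l : peval (theta_mx i l) x = coord e l (theta x e`_i).
Proof.
rewrite mxE /peval raddf_sum {2}(coord_vbasis (memvf x)).
rewrite linear_sum sum_lfunE linear_sum.
apply: eq_bigr => t _.
by rewrite /= mevalZ mevalXU linearZ /= scale_lfunE linearZ mulrC.
Qed.

Lemma theta_pow_mxE x j i l :
  peval (theta_pow_mx j i l) x = coord e l (theta_pow x j e`_i).
Proof.
elim: j i l => [|j IH] i l.
  rewrite mxE /theta_pow /= id_lfunE coord_free ?(basis_free (vbasisP _)) //.
  by rewrite /peval rmorph_nat eq_sym.
rewrite /= mxE /peval raddf_sum /= comp_lfunE.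
rewrite -/(theta_pow x j) {1}(coord_vbasis (memvf (theta_pow x j e`_i))).
rewrite !linear_sum.
apply: eq_bigr => c _; rewrite !linearZ mevalM -!/(peval _ _) /=.
by rewrite [X in X * _]IH [X in _ * X]theta_mxE.
Qed.

Lemma theta_pow_mx_homog j i l : theta_pow_mx j i l \is j.-homog.
Proof.
elim: j i l => [|j IH] i l.
  by rewrite mxE; case: (_ == _); [apply: dhomog1|apply: dhomog0].
rewrite /= mxE; apply: rpred_sum => c _; rewrite -addn1.
apply: dhomogM; first exact: IH.
rewrite mxE; apply: rpred_sum => t _; apply: rpredZ.
by rewrite dhomogX; apply/eqP; exact: mdeg1.
Qed.

Variables (j d : nat).

Local Notation E := (exterior_power M d).

Definition image_minor (I : 'I_d -> 'I_n) (s : increasing_map M d) :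
    {mpoly k[\dim {:W}]} :=
  \det (\matrix_(i < d, l < d) theta_pow_mx j (I i) (val s l)).

Definition image_wedge (I : 'I_d -> 'I_n) (i : 'I_(\dim {:E})) :
    {mpoly k[\dim {:W}]} :=
  \sum_s coord (vbasis {:E}) i [ffun t => (t == s)%:R] *: image_minor I s.

Lemma image_wedge_homog I i : image_wedge I i \is (d * j).-homog.
Proof.
apply: rpred_sum => s _; apply: rpredZ; apply: rpred_sum => t _.
rewrite rpredMsign -[d in (d * j)%N]card_ord -sum_nat_const.
by apply: homog_prod_ord => l; rewrite mxE; apply: theta_pow_mx_homog.
Qed.

Lemma pmap_eval_image_wedge I x :
  pmap_eval (image_wedge I) x = wedge (fun i => theta_pow x j e`_(I i)).
Proof.
set y := wedge _; rewrite [RHS](coord_vbasis (memvf y)).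
apply: eq_bigr => i _; congr (_ *: _).
have yE : y = \sum_s (y s) *: ([ffun t => (t == s)%:R] : E).
  apply/ffunP => t; rewrite sum_ffunE (bigD1 t) //= !ffunE eqxx [_ *: _]mulr1.
  rewrite big1 ?addr0 // => s; rewrite !ffunE eq_sym => /negPf->.
  by rewrite [_ *: _]mulr0.
rewrite {1}yE linear_sum /peval raddf_sum; apply: eq_bigr => s _.
rewrite /= mevalZ linearZ /= mulrC; congr (_ * _).
rewrite -det_map_mx ffunE; congr (\det _); apply/matrixP => a b.
by rewrite !mxE -theta_pow_mxE.
Qed.

Lemma represents_image_map (U : set W) : (0 < \dim {:W})%N ->
  (forall x : W, x != 0 -> U x) ->
  (forall x : W, x != 0 -> \dim (limg (theta_pow x j)) = d) ->
  exists D f,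
    represents_morphism U (fun x => plucker d (limg (theta_pow x j))) D f.
Proof.
move=> W_gt0 UW rk; apply: (represents_morphism_glue W_gt0 UW image_wedge_homog).
  move=> x x_neq0; have [I Ix] := exists_wedge_neq0 (rk x x_neq0).
  by exists I; rewrite pmap_eval_image_wedge.
move=> x I x_neq0; rewrite pmap_eval_image_wedge; apply: plucker_wedge.
  exact: rk.
by move=> i; apply: memv_img; apply: memvf.
Qed.

End PowerImages.

(** * Restriction to a p-subalgebra *)

Section Rank.
Variables (k : fieldType) (p : nat) (L : restrictedLieAlg k p).
Variables (M : fdModule (restr_env L)) (j : nat).
Hypothesis j_gt0 : (0 < j)%N.

Lemma operator_linear : linear (operator M : L -> 'End(M)).
Proof. by move=> a x y; rewrite /operator restr_env_in_linear fdact_linear. Qed.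

HB.instance Definition _ :=
  GRing.isLinear.Build k L 'End(M) *:%R (operator M) operator_linear.

Lemma oprank0 : oprank M j 0 = 0%N.
Proof.
case: j j_gt0 => // i _; rewrite /oprank /operator_pow /= linear0 comp_lfun0l.
rewrite (_ : limg 0 = 0%VS) ?dimv0 //; apply/eqP; rewrite -subv0.
by apply/subvP => _ /memv_imgP[u _ ->]; rewrite zero_lfunE mem0v.
Qed.

Lemma generic_rankE x0 : constant_rank M j -> nullcone x0 -> x0 != 0 ->
  generic_rank M j = oprank M j x0.
Proof.
move=> Mj x0V x0_neq0; apply/eqP; rewrite eqn_leq; apply/andP; split.
  apply/bigmax_leqP => r /asboolP[x xV <-].
  have [->|x_neq0] := eqVneq x 0; first by rewrite oprank0.
  by rewrite (Mj x x0).
have r0 : (oprank M j x0 < (\dim {:M}).+1)%N by rewrite ltnS dimvS ?subvf.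
apply: (bigmax_sup (Ordinal r0)) => //; apply/asboolP; exists x0 => //.
Qed.

End Rank.

Lemma nullspaceP (k : fieldType) (p : nat) (L : restrictedLieAlg k p) :
  nullcone_is_subspace L -> is_nullspace (nullspace L).
Proof. by move=> LV; apply: (@xgetPex _ 0%VS [set V | is_nullspace V] LV). Qed.

Lemma nullcone_is_subspaceP (k : fieldType) (p : nat) (L : restrictedLieAlg k p) :
  (0 < \dim (nullspace L))%N -> nullcone_is_subspace L.
Proof.
apply: contraPP => LV; rewrite /nullspace xgetPN ?dimv0 // => V VL.
by apply: LV; exists V.
Qed.

Section Restriction.
Variables (k : closedFieldType) (p : nat) (g : restrictedLieAlg k p).
Variables (h : {vspace g}) (hh : p_subalgebra h).
Hypotheses (gV : nullcone_is_subspace g).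
Hypotheses (hV : nullcone_is_subspace (sub_rlie hh)).

Local Notation H := (sub_rlie hh).

Lemma nullcone_sub (x : H) : nullcone x <-> nullcone (vsval x : g).
Proof.
rewrite /nullcone /=; split=> [x0|x0]; last first.
  by apply: subvs_inj; rewrite (val_sub_pmap hh) linear0.
by rewrite -(val_sub_pmap hh) [sub_pmap _]x0 linear0.
Qed.

Definition nullspace_incl (x : subvs_of (nullspace H)) : subvs_of (nullspace g) :=
  vsproj (nullspace g) (vsval (vsval x : subvs_of h)).

Lemma nullspace_incl_linear : linear nullspace_incl.
Proof. by move=> a x y; rewrite /nullspace_incl !linearP. Qed.

HB.instance Definition _ :=
  GRing.isLinear.Build k (subvs_of (nullspace H)) (subvs_of (nullspace g)) *:%R
    nullspace_incl nullspace_incl_linear.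

Lemma val_nullspace_incl x :
  vsval (nullspace_incl x) = vsval (vsval x : subvs_of h).
Proof.
rewrite vsprojK //; apply/(nullspaceP gV)/nullcone_sub/(nullspaceP hV).
exact: subvsP.
Qed.

Lemma nullspace_incl_neq0 x : x != 0 -> nullspace_incl x != 0.
Proof.
apply: contraNneq => x0; apply/eqP; do 2!apply: subvs_inj.
by rewrite -val_nullspace_incl x0 !linear0.
Qed.

Variable M : fdModule (restr_env g).

Lemma operator_restrict (x : H) :
  operator (restrict_mod hh M) x = operator M (vsval x).
Proof.
rewrite /operator /= /pullback_act; congr (fdact M _).
exact: restr_env_lift_in.
Qed.

Lemma operator_pow_restrict (x : H) j :
  operator_pow (restrict_mod hh M) x j = operator_pow M (vsval x) j.
Proof.
rewrite /operator_pow; elim: j => [|j IH]; first by [].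
by rewrite !iterS IH operator_restrict.
Qed.

Lemma oprank_restrict (x : H) j :
  oprank (restrict_mod hh M) j x = oprank M j (vsval x).
Proof. by rewrite /oprank operator_pow_restrict. Qed.

Lemma constant_rank_restrict j :
  constant_rank M j -> constant_rank (restrict_mod hh M) j.
Proof.
move=> Mj x y /nullcone_sub xV /nullcone_sub yV x_neq0 y_neq0.
rewrite (oprank_restrict x j) (oprank_restrict y j).
exact: Mj.
Qed.

End Restriction.

Section NullspaceOperator.
Variables (k : fieldType) (p : nat) (L : restrictedLieAlg k p).
Variable M : fdModule (restr_env L).

Definition nullspace_operator (x : subvs_of (nullspace L)) : 'End(M) :=
  operator M (vsval x).

Lemma nullspace_operator_linear : linear nullspace_operator.
Proof. by move=> a x y; rewrite /nullspace_operator !linearP. Qed.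

HB.instance Definition _ :=
  GRing.isLinear.Build k (subvs_of (nullspace L)) 'End(M) *:%R
    nullspace_operator nullspace_operator_linear.

End NullspaceOperator.

Theorem theorem4p1p2 (k : closedFieldType) (p : nat) (charkp : p \in [pchar k])
    (g : restrictedLieAlg k p) (Vg : nullcone_is_subspace g)
    (h : {vspace g}) (hh : p_subalgebra h)
    (dimVh : (2 <= \dim (nullspace (sub_rlie hh)))%N)
    (j : nat) (hj : (0 < j < p)%N)
    (M : fdModule (restr_env g)) (Mj : constant_rank M j) :
  jdegree M j = jdegree (restrict_mod hh M) j.
Proof.
have [j_gt0 _] := andP hj.
have hV := nullcone_is_subspaceP (ltnW dimVh).
have Wh : (1 < \dim {: subvs_of (nullspace (sub_rlie hh))})%N by rewrite dimvf.
have [y0 y0_neq0] := exists_neq0 (ltnW Wh).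
pose x0 := nullspace_incl y0.
have x0_neq0 : x0 != 0 := nullspace_incl_neq0 Vg hV y0_neq0.
have Wg : (0 < \dim {: subvs_of (nullspace g)})%N.
  rewrite lt0n; apply: contraNneq x0_neq0 => W0.
  rewrite -memv0; have := memvf x0; rewrite (_ : fullv = 0%VS) //.
  by apply/eqP; rewrite -dimv_eq0 W0.
have rk (x : subvs_of (nullspace g)) :
    x != 0 -> generic_rank M j = oprank M j (vsval x).
  move=> x_neq0; apply: generic_rankE => //.
  by apply/(nullspaceP Vg); apply: subvsP.
have rk' (x : subvs_of (nullspace (sub_rlie hh))) : x != 0 ->
    generic_rank (restrict_mod hh M) j = oprank (restrict_mod hh M) j (vsval x).
  move=> x_neq0; have xV : nullcone (vsval x).
    by apply/(nullspaceP hV); apply: subvsP.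
  exact: (generic_rankE j_gt0 (constant_rank_restrict (hh := hh) Mj) xV x_neq0).
have rkE : generic_rank (restrict_mod hh M) j = generic_rank M j.
  by rewrite (rk' y0) // oprank_restrict -val_nullspace_incl // -rk.
rewrite /jdegree rkE; case: ifP => // _.
have UW (x : subvs_of (nullspace g)) : x != 0 -> degree_locus M j x.
  by move/rk/esym.
have UW' (x : subvs_of (nullspace (sub_rlie hh))) :
  x != 0 -> degree_locus (restrict_mod hh M) j x by move/rk'/esym.
have [D [f fD]] : exists D f, represents_morphism (degree_locus M j)
    (fun x => plucker (generic_rank M j) (image_map M j x)) D f.
  apply: (represents_image_map (theta := nullspace_operator M) Wg UW).
  by move=> x /rk/esym.
pose phi' x : {vspace exterior_power M (generic_rank M j)} :=
  plucker (generic_rank M j) (image_map (restrict_mod hh M) j x).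
have phiE x : x != 0 ->
    phi' x = plucker (generic_rank M j) (image_map M j (nullspace_incl x)).
  move=> _; rewrite /phi' /image_map val_nullspace_incl //.
  by rewrite operator_pow_restrict.
have fD' := represents_morphism_restrict
  (nullspace_incl_neq0 Vg hV) Wh UW UW' phiE fD.
rewrite (morphism_degreeP Wg UW fD); apply/esym.
exact: (morphism_degreeP (ltnW Wh) UW' fD').
Qed.
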